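(* Fix $\beta \in \mathbb{R}_{>0}$, and let $\omega$ be the random permutation of $\{1,\dots,N\}$ distributed according to the Mallows measure $\mathcal{M}_{N}^{q}$, $q=1-\beta/N$, $N \in \mathbb{N}$. Fix $x,y\in(0,1)$. Then for any $\delta \in (h_{\beta}(x, y), \min\{x,y\}]$, $$\lim_{N\to\infty}\frac{1}{N} \ln \mathcal{M}_{N}^{q} \left( H_{\lfloor x N\rfloor, \lfloor y N\rfloor}(\omega)\geq\lfloor\delta N\rfloor \right)=-a_{\beta}(x,y; \delta),$$ and for any $\delta \in [\max\{x+y-1,0\}, h_{\beta}(x, y))$, $$\lim_{N\to\infty}\frac{1}{N} \ln \mathcal{M}_{N}^{q} \left( H_{\lfloor x N\rfloor, \lfloor y N\rfloor}(\omega) \leq \lfloor\delta N\rfloor \right)=-a_{\beta}(x,y; \delta),$$ where $$h_{\beta}(x, y)=\frac{1}{\beta}\left[\ln(1-e^{-\beta})-\ln(e^{-\beta x}+e^{-\beta y}-e^{-\beta(x+y)}-e^{-\beta})\right]$$ and $$a_{\beta}(x, y;\delta)=\frac{1}{\beta}\Big(\beta^2(x-\delta)(y-\delta)-\frac{\pi^2}{6}+Li_{2}(e^{-\beta\delta })+Li_{2}(e^{- \beta(x-\delta)})+Li_{2}(e^{- \beta(y-\delta)})+Li_{2}(e^{- \beta(1-x-y+\delta)})$$ $$+Li_{2}(e^{-\beta})-Li_{2}(e^{-\beta x })-Li_{2}(e^{- \beta y })-Li_{2}(e^{-\beta(1-x) })-Li_{2}(e^{-\beta(1-y)})\Big).$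$
   Context: For $q\in[0,1)$, the Mallows measure $\mathcal{M}_N^q$ on permutations of $\{1,\dots,N\}$ assigns to a permutation $w$ the probability $q^{\mathrm{inv}(w)}Y_N$, where $\mathrm{inv}(w)$ is the number of inversions of $w$ and $Y_N=\prod_{j=1}^N\frac{1-q}{1-q^j}$. With $q=1-\beta/N$ one considers $N$ large enough that $q\in[0,1)$. The height function of a permutation $\omega$ of size $N$ is $H_{L,K}(\omega) := \#\{ i : 1 \le i \le L,\ 1 \le \omega(i) \le K \}$, for integers $1\le L,K\le N$. $Li_2(z)=\sum_{n\ge1} z^n/n^2$ for $|z|\le 1$ is the Euler dilogarithm (so $Li_2(1)=\pi^2/6$). *)

(* Defs.v *)
From HB Require Import structures.
From mathcomp Require Import all_boot all_order all_algebra all_fingroup.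
From mathcomp Require Import all_classical all_reals all_analysis.

Set Implicit Arguments.
Unset Strict Implicit.
Unset Printing Implicit Defensive.

Import Order.TTheory GRing.Theory Num.Theory.
Import numFieldNormedType.Exports.

Local Open Scope classical_set_scope.
Local Open Scope ring_scope.

(* Permutations of {1, ..., N} are elements of 'S_N, i.e. permutations of
   'I_N = {0, ..., N - 1}: the index i : 'I_N stands for i + 1. *)

Definition inv (N : nat) (w : 'S_N) : nat :=
  #|[set p : 'I_N * 'I_N | (p.1 < p.2)%N && (w p.2 < w p.1)%N]%SET|.

Definition mallows_norm (R : realType) (q : R) (N : nat) : R :=
  \prod_(1 <= j < N.+1) ((1 - q) / (1 - q ^+ j)).

Definition mallows_pmf (R : realType) (N : nat) (q : R) (w : 'S_N) : R :=
  q ^+ inv w * mallows_norm q N.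

Definition mallows (R : realType) (N : nat) (q : R) (A : {set 'S_N}) : R :=
  \sum_(w in A) mallows_pmf q w.

(* Because of the index shift, 1 <= i <= L and 1 <= w(i) <= K become
   i < L and w i < K. *)
Definition height (N : nat) (w : 'S_N) (L K : nat) : nat :=
  #|[set i : 'I_N | (i < L)%N && (w i < K)%N]%SET|.

(* Meaningful for `|z| <= 1, where the series converges. *)
Definition Li2 (R : realType) (z : R) : R :=
  limn (series (fun n : nat => z ^+ n.+1 / n.+1%:R ^+ 2)).

Definition h_limit (R : realType) (beta x y : R) : R :=
  beta^-1 * (ln (1 - expR (- beta))
             - ln (expR (- (beta * x)) + expR (- (beta * y))
                   - expR (- (beta * (x + y))) - expR (- beta))).

Definition a_rate (R : realType) (beta x y delta : R) : R :=
  beta^-1 *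
  (beta ^+ 2 * (x - delta) * (y - delta) - pi ^+ 2 / 6
   + Li2 (expR (- (beta * delta)))
   + Li2 (expR (- (beta * (x - delta))))
   + Li2 (expR (- (beta * (y - delta))))
   + Li2 (expR (- (beta * (1 - x - y + delta))))
   + Li2 (expR (- beta))
   - Li2 (expR (- (beta * x)))
   - Li2 (expR (- (beta * y)))
   - Li2 (expR (- (beta * (1 - x))))
   - Li2 (expR (- (beta * (1 - y))))).

(* Main.v *)
Require Import Defs.
From HB Require Import structures.
From mathcomp Require Import all_boot all_order all_algebra all_fingroup.
From mathcomp Require Import all_classical all_reals all_analysis.
From mathcomp Require Import zify ring lra.

Set Implicit Arguments.
Unset Strict Implicit.
Unset Printing Implicit Defensive.

Import Order.TTheory GRing.Theory Num.Theory.
Import numFieldNormedType.Exports.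

Local Open Scope classical_set_scope.
Local Open Scope ring_scope.

(** The height function of a Mallows permutation has an explicit law.  Removing
    the last letter of a permutation shows that the probability $P(k)$ of
    $H_{L,K} = k$ obeys a two-term recursion in $N$ ([hlawS]), solved by the
    $q$-hypergeometric weights
    $$P(k) = q^{ab} \frac{(q)_{k+b} (q)_{a+c} (q)_{k+a} (q)_{b+c}}
                         {(q)_k (q)_a (q)_b (q)_c (q)_N},$$
    where $a = K - k$, $b = L - k$, $c = N + k - L - K$ and $(q)_n$ is the
    $q$-Pochhammer symbol ([hlawE]).  The ratio $P(k+1)/P(k)$ decreases in $k$,
    so the law is unimodal, and the sign of [drift] tells whether a given $k$
    lies above or below the mode ([hlaw_le_mode], [hlaw_ge_mode]).  At
    $k = \lfloor \delta N \rfloor$ the drift converges to a positive multiple of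
    $e^{-\beta h} - e^{-\beta\delta}$ ([drift_limitE]).  Hence for $\delta$ on
    the relevant side of $h = h_\beta(x, y)$ the most likely height within the
    event is $\lfloor \delta N \rfloor$ itself, and the probability of the event
    lies between $P(\lfloor \delta N \rfloor)$ and $N + 1$ times this value
    ([mallows_height_bounds]).

    It remains to find the exponential rate of $P(\lfloor \delta N \rfloor)$.
    Expanding the logarithms in $-\ln (q)_m$ and summing over the factors gives
    $\sum_n \frac{q^n (1 - q^{mn})}{n (1 - q^n)}$.  For $q = 1 - \beta/N$ and
    $m/N \to a$, its $n$-th term divided by $N$ tends to
    $(1 - e^{-\beta a n})/(\beta n^2)$ and is at most $1/(\beta n^2)$, whence
    $\frac1N \ln (q)_m \to \beta^{-1} (Li_2(e^{-\beta a}) - Li_2(1))$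
    ([cvg_ln_qpoch]).  The four numerators and five denominators leave a single
    $Li_2(1)$, and $Li_2(1) = \pi^2/6$ ([Li2_1]).  The latter is obtained
    from $\sin^{-2} x = \frac14 (\sin^{-2} \frac x2 + \cos^{-2} \frac x2)$:
    iterated from $x = \pi/4$, it evaluates the sum of $\sin^{-2}$ over the odd
    multiples of $\pi/2^{n+2}$ in $(0, \pi/2)$, while
    $x^{-2} \le \sin^{-2} x \le x^{-2} + 1$ there. *)

(** * The law of the height function *)

(** A permutation of $n + 1$ letters amounts to its value at [i0] and a
    permutation of the other $n$ letters. *)
Lemma sum_lift_perm (V : nmodType) n (i0 : 'I_n.+1) (F : 'S_n.+1 -> V) :
  \sum_(w : 'S_n.+1) F w = \sum_(j < n.+1) \sum_(s : 'S_n) F (lift_perm i0 j s).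
Proof.
rewrite (partition_big (fun w : 'S_n.+1 => w i0) predT) //=.
apply: eq_bigr => j0 _; rewrite (reindex (lift_perm i0 j0)) /=.
  by apply: eq_bigl => s; rewrite lift_perm_id eqxx.
pose ulsf i (s : 'S_n.+1) k := odflt k (unlift (s i) (s (lift i k))).
have ulsfK i (s : 'S_n.+1) k : lift (s i) (ulsf i s k) = s (lift i k).
  rewrite /ulsf; have := neq_lift i k.
  by rewrite -(can_eq (permK s)) => /unlift_some[] ? ? ->.
have inj_ulsf : injective (ulsf i0 _).
  move=> s; apply: can_inj (ulsf (s i0) s^-1%g) _ => k'.
  by rewrite {1}/ulsf ulsfK !permK liftK.
exists (fun s => perm (inj_ulsf s)) => [s _ | s].
  by apply/permP=> k'; rewrite permE /ulsf lift_perm_lift lift_perm_id liftK.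
move/eqP => si0; apply/permP=> k.
case: (unliftP i0 k) => [k'|] ->; rewrite ?lift_perm_id //.
by rewrite lift_perm_lift -si0 permE ulsfK.
Qed.

Lemma inv_sum n (w : 'S_n) :
  Defs.inv w = (\sum_(i < n) \sum_(k < n) ((i < k) && (w k < w i) : nat))%N.
Proof.
rewrite /Defs.inv -sum1dep_card big_mkcond pair_bigA /=.
by apply: eq_bigr => -[i k] _ /=; case: ifP.
Qed.

Lemma height_sum n (w : 'S_n) L K :
  height w L K = (\sum_(i < n) ((i < L) && (w i < K) : nat))%N.
Proof.
rewrite /height -sum1dep_card big_mkcond /=.
by apply: eq_bigr => i _ /=; case: ifP.
Qed.

Lemma sum_ge_ord n j : (\sum_(v < n) (j <= v : nat))%N = (n - j)%N.
Proof.
elim: n => [|n IH]; first by rewrite big_ord0.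
by rewrite big_ord_recr /= IH; case: leqP => h; lia.
Qed.

Lemma widen_lift n (i : 'I_n) : widen_ord (leqnSn n) i = lift ord_max i.
Proof. by apply: val_inj => /=; rewrite /bump leqNgt ltn_ord. Qed.

(** A last letter $j$ forms an inversion with each of the $n - j$ larger
    values. *)
Lemma inv_lift_perm n (j : 'I_n.+1) (s : 'S_n) :
  Defs.inv (lift_perm ord_max j s) = (Defs.inv s + (n - j))%N.
Proof.
rewrite !inv_sum big_ord_recr /= [X in (_ + X)%N]big1 ?addn0; last first.
  by move=> k _; rewrite ltnNge -ltnS ltn_ord.
rewrite -[X in (_ + X)%N](sum_ge_ord n j).
rewrite [X in (_ + X)%N](reindex_inj (@perm_inj _ s)) /= -big_split /=.
apply: eq_bigr => i _; rewrite big_ord_recr /=; congr (_ + _)%N.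
  apply: eq_bigr => k _; rewrite !widen_lift !lift_perm_lift /= /bump.
  by case: (leqP j (s k)) => ?; case: (leqP j (s i)) => ?; lia.
by rewrite ltn_ord /= lift_perm_id !widen_lift lift_perm_lift /= /bump; lia.
Qed.

(** The removed letter lies outside the first $L$ positions; it shifts the
    threshold $K$ exactly when its value $j$ is below $K$. *)
Lemma height_lift_perm n (j : 'I_n.+1) (s : 'S_n) L K : (L <= n)%N ->
  height (lift_perm ord_max j s) L K = height s L (K - (j < K))%N.
Proof.
move=> Ln; rewrite !height_sum big_ord_recr /= ltnNge Ln /= addn0.
apply: eq_bigr => i _; rewrite widen_lift lift_perm_lift /= /bump.
by case: (ltnP j K) => h; case: (leqP j (s i)) => h'; lia.
Qed.

Lemma height_leL n (w : 'S_n) L K : (height w L K <= L)%N.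
Proof.
have h m : (\sum_(i < m) (i < L : nat))%N = minn m L.
  elim: m => [|m IH]; first by rewrite big_ord0 min0n.
  by rewrite big_ord_recr /= IH; lia.
apply: leq_trans (geq_minr n L); rewrite -h height_sum.
by apply: leq_sum => i _; lia.
Qed.

Lemma height_leK n (w : 'S_n) L K : (height w L K <= K)%N.
Proof.
have h m : (\sum_(i < m) (i < K : nat))%N = minn m K.
  elim: m => [|m IH]; first by rewrite big_ord0 min0n.
  by rewrite big_ord_recr /= IH; lia.
apply: leq_trans (geq_minr n K); rewrite -h height_sum.
rewrite [X in (_ <= X)%N](reindex_inj (@perm_inj _ w)) /=.
by apply: leq_sum => i _; lia.
Qed.

(** Inclusion-exclusion for the first $L$ positions and the positions of the
    first $K$ values. *)
Lemma height_ge n (w : 'S_n) L K : (L <= n)%N -> (K <= n)%N ->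
  (L + K <= n + height w L K)%N.
Proof.
have h J m : (\sum_(i < m) (i < J : nat))%N = minn m J.
  elim: m => [|m IH]; first by rewrite big_ord0 min0n.
  by rewrite big_ord_recr /= IH; lia.
move=> /minn_idPr Ln /minn_idPr Kn.
have -> : (n + height w L K = \sum_(i < n) (1 + ((i < L) && (w i < K) : nat)))%N.
  by rewrite big_split /= sum1_card card_ord height_sum.
rewrite -{1}Ln -{1}Kn -!h.
rewrite [X in (_ + X <= _)%N](reindex_inj (@perm_inj _ w)) /= -big_split /=.
by apply: leq_sum => i _; lia.
Qed.

(** The $q$-Pochhammer symbol $(q;q)_n$. *)
Definition qpoch (R : realType) (q : R) (n : nat) : R :=
  \prod_(j < n) (1 - q ^+ j.+1).

(** The Mallows probability that the height at $(L, K)$ equals $k$ *)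
Definition hlaw (R : realType) (q : R) (N L K k : nat) : R :=
  mallows q [set w : 'S_N | height w L K == k]%SET.

Lemma qpochS (R : realType) (q : R) n :
  qpoch q n.+1 = qpoch q n * (1 - q ^+ n.+1).
Proof. by rewrite /qpoch big_ord_recr. Qed.

Lemma qpoch0 (R : realType) (q : R) : qpoch q 0 = 1.
Proof. by rewrite /qpoch big_ord0. Qed.

Lemma subr1X_gt0 (R : realType) (q : R) n : 0 < q < 1 -> 0 < 1 - q ^+ n.+1.
Proof. by move=> /andP[q0 q1]; rewrite subr_gt0 exprn_ilt1 // ltW. Qed.

Lemma subr1X_ge0 (R : realType) (q : R) n : 0 < q < 1 -> 0 <= 1 - q ^+ n.
Proof.
by case: n => [|n] q01; rewrite ?expr0 ?subrr // ltW // subr1X_gt0.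
Qed.

Lemma qpoch_gt0 (R : realType) (q : R) n : 0 < q < 1 -> 0 < qpoch q n.
Proof. by move=> q01; apply: prodr_gt0 => j _; apply: subr1X_gt0. Qed.

Lemma mallowsE (R : realType) (q : R) N (A : pred 'S_N) :
  mallows q [set w | A w]%SET = \sum_w (if A w then mallows_pmf q w else 0).
Proof. by rewrite /mallows big_mkcond; apply: eq_bigr => w _; rewrite inE. Qed.

Lemma mallows_normS (R : realType) (q : R) N : 0 < q < 1 ->
  (1 - q ^+ N.+1) * mallows_norm q N.+1 = (1 - q) * mallows_norm q N.
Proof.
move=> /(subr1X_gt0 N)/lt0r_neq0 h.
by rewrite /mallows_norm big_nat_recr //=; field.
Qed.

(** Under the Mallows measure the last letter is truncated geometric and
    independent of the relative order of the other letters. *)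
Lemma mallows_lift (R : realType) (q : R) N (A : pred 'S_N.+1) : 0 < q < 1 ->
  (1 - q ^+ N.+1) * mallows q [set w | A w]%SET =
  \sum_(j < N.+1) (q ^+ (N - j) * (1 - q)) *
    mallows q [set s : 'S_N | A (lift_perm ord_max j s)]%SET.
Proof.
move=> q01; rewrite mallowsE (sum_lift_perm ord_max) mulr_sumr.
apply: eq_bigr => j _; rewrite mallowsE !mulr_sumr; apply: eq_bigr => s _.
case: ifP => _; last by rewrite !mulr0.
rewrite /mallows_pmf inv_lift_perm exprD mulrCA mallows_normS //; ring.
Qed.

Lemma sum_geom_lt (R : realType) (q : R) n m : (m <= n)%N ->
  \sum_(j < n | (j < m)%N) q ^+ (n.-1 - j) * (1 - q) = q ^+ (n - m) * (1 - q ^+ m).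
Proof.
move=> mn; rewrite (big_ord_narrow mn) /=.
elim: m mn => [|m IH] mn; first by rewrite big_ord0 expr0 subrr mulr0.
rewrite big_ord_recr /= IH; last exact: ltnW.
have -> : (n.-1 - m = n - m.+1)%N by lia.
have -> : (n - m = (n - m.+1).+1)%N by lia.
by rewrite !exprS; ring.
Qed.

Lemma sum_geom_ge (R : realType) (q : R) n m : (m <= n)%N ->
  \sum_(j < n | ~~ (j < m)%N) q ^+ (n.-1 - j) * (1 - q) = 1 - q ^+ (n - m).
Proof.
move=> mn; apply: (@addrI _ (\sum_(j < n | (j < m)%N) q ^+ (n.-1 - j) * (1 - q))).
have := bigID (fun j : 'I_n => (j < m)%N) predT
  (fun j : 'I_n => q ^+ (n.-1 - j) * (1 - q)) (op := +%R) (idx := 0).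
move=> /= <-; rewrite sum_geom_lt //.
transitivity (1 - q ^+ n).
  have := @sum_geom_lt R q n n (leqnn n); rewrite subnn expr0 mul1r => <-.
  by apply: eq_bigl => j; rewrite ltn_ord.
by rewrite -{1}(subnK mn) exprD; ring.
Qed.

Lemma mallowsT (R : realType) (q : R) N : 0 < q < 1 ->
  mallows q [set: 'S_N]%SET = 1.
Proof.
move=> q01; elim: N => [|N IH].
  rewrite /mallows (big_pred1 (1%g : 'S_0)); last first.
    by move=> w; rewrite inE; apply/esym/eqP/permP => -[].
  by rewrite /mallows_pmf inv_sum big_ord0 /mallows_norm big_geq // mulr1.
apply: (mulfI (lt0r_neq0 (subr1X_gt0 N q01))).
have := mallows_lift (predT : pred 'S_N.+1) q01.
have T n : [set w : 'S_n | predT w]%SET = [set: 'S_n]%SET.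
  by apply/finset.setP => w; rewrite !inE.
rewrite T => ->; rewrite mulr1.
transitivity (\sum_(j < N.+1) q ^+ (N - j) * (1 - q)).
  apply: eq_bigr => j _.
  by rewrite (_ : [set _ | _]%SET = [set: 'S_N]%SET) ?IH ?mulr1.
have := @sum_geom_lt R q N.+1 N.+1 (leqnn _); rewrite subnn expr0 mul1r => <-.
by apply: eq_bigl => j; rewrite ltn_ord.
Qed.

(** Recursion in the size, from the position of the last letter relative to the
    threshold $K$.  For $K = 0$ the meaningless [K.-1] comes with coefficient
    $0$. *)
Lemma hlawS (R : realType) (q : R) N L K k : 0 < q < 1 -> (L <= N)%N ->
  (K <= N.+1)%N ->
  (1 - q ^+ N.+1) * hlaw q N.+1 L K k =
  q ^+ (N.+1 - K) * (1 - q ^+ K) * hlaw q N L K.-1 k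
  + (1 - q ^+ (N.+1 - K)) * hlaw q N L K k.
Proof.
move=> q01 LN KN; rewrite /hlaw mallows_lift //.
under eq_bigr => j _.
  under [X in mallows q X]finset.eq_finset do rewrite height_lift_perm //.
  over.
rewrite (bigID (fun j : 'I_N.+1 => (j < K)%N)) /=.
rewrite -(@sum_geom_lt _ q N.+1 K KN) -(@sum_geom_ge _ q N.+1 K KN) /= !mulr_suml.
congr (_ + _); apply: eq_bigr => j h; first by rewrite h subn1.
by rewrite (negPf h) subn0.
Qed.

Lemma hlaw0 (R : realType) (q : R) N L K k :
  (forall w : 'S_N, height w L K != k) -> hlaw q N L K k = 0.
Proof.
move=> h; rewrite /hlaw mallowsE big1 // => w _.
by rewrite (negPf (h w)).
Qed.

Lemma hlaw_gtL (R : realType) (q : R) N L K k : (L < k)%N -> hlaw q N L K k = 0.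
Proof. by move=> h; apply: hlaw0 => w; have := height_leL w L K; lia. Qed.

Lemma hlaw_gtK (R : realType) (q : R) N L K k : (K < k)%N -> hlaw q N L K k = 0.
Proof. by move=> h; apply: hlaw0 => w; have := height_leK w L K; lia. Qed.

Lemma hlaw_lt (R : realType) (q : R) N L K k : (L <= N)%N -> (K <= N)%N ->
  (N + k < L + K)%N -> hlaw q N L K k = 0.
Proof.
by move=> LN KN h; apply: hlaw0 => w; have := height_ge w LN KN; lia.
Qed.

(** The law of the height function: with $k$ the height, $a$, $b$ and $c$ count
    the points of the permutation in the other three quadrants cut out by
    $(L, K)$. *)
Lemma hlawE (R : realType) (q : R) k a b c : 0 < q < 1 ->
  hlaw q (k + a + b + c) (k + b) (k + a) k *
    (qpoch q k * qpoch q a * qpoch q b * qpoch q c * qpoch q (k + a + b + c)) =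
  q ^+ (a * b) * (qpoch q (k + b) * qpoch q (a + c) * qpoch q (k + a)
                  * qpoch q (b + c)).
Proof.
move=> q01; move: {2}(a + c)%N (erefl (a + c)%N) => n.
elim: n a c => [|n IH] a c.
  move=> /eqP; rewrite addn_eq0 => /andP[/eqP -> /eqP ->].
  rewrite !addn0 mul0n expr0 !qpoch0.
  rewrite /hlaw (_ : [set w | _]%SET = [set: 'S__]%SET) ?(mallowsT _ q01).
    by ring.
  apply/finset.setP => w; rewrite !inE.
  have := height_leK w (k + b) k; have := @height_ge _ w (k + b) k (leqnn _).
  by move=> /(_ (leq_addr _ _)); lia.
move=> acn.
have NE : (k + a + b + c = (k + b + n).+1)%N by lia.
pose N := (k + b + n)%N.
pose Q := qpoch q k * qpoch q a * qpoch q b * qpoch q c * qpoch q N.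
pose P := q ^+ (a * b) * (qpoch q (k + b) * qpoch q n * qpoch q (k + a)
                          * qpoch q (b + c)).
(* T1 and T2 are the two terms of the recursion; they add up to the claim
   because $(1 - q^a) q^c + (1 - q^c) = 1 - q^{a+c}$. *)
have T1 : q ^+ (b + c) * (1 - q ^+ (k + a)) * hlaw q N (k + b) (k + a).-1 k * Q
          = (1 - q ^+ a) * q ^+ c * P.
  rewrite /Q /P; case: a acn {NE Q P} => [|a] acn.
    rewrite addn0 expr0 subrr !mul0r; have [->|k0] := posnP k.
      by rewrite expr0 subrr mulr0 !mul0r.
    by rewrite hlaw_gtK ?ltn_predL // mulr0 mul0r.
  have an : (a + c)%N = n by lia.
  have := IH _ _ an; rewrite an !addnS /=.
  have -> : (k + a + b + c = N)%N by rewrite /N; lia.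
  rewrite !qpochS mulSn !exprD => H.
  pose t := q ^+ b * q ^+ c * (1 - q ^+ (k + a).+1) * (1 - q ^+ a.+1).
  transitivity (t * (hlaw q N (k + b) (k + a) k *
    (qpoch q k * qpoch q a * qpoch q b * qpoch q c * qpoch q N))).
    by rewrite /t; ring.
  by rewrite H /t; ring.
have T2 : (1 - q ^+ (b + c)) * hlaw q N (k + b) (k + a) k * Q = (1 - q ^+ c) * P.
  rewrite /Q /P; case: c acn {NE Q P T1} => [|c] acn.
    rewrite addn0 expr0 subrr !mul0r; have [->|b0] := posnP b.
      by rewrite expr0 subrr !mul0r.
    by rewrite hlaw_lt ?mulr0 ?mul0r // /N; lia.
  have an : (a + c)%N = n by lia.
  have := IH _ _ an; rewrite an !addnS /=.
  have -> : (k + a + b + c = N)%N by rewrite /N; lia.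
  rewrite !qpochS => H.
  pose t := (1 - q ^+ (b + c).+1) * (1 - q ^+ c.+1).
  transitivity (t * (hlaw q N (k + b) (k + a) k *
    (qpoch q k * qpoch q a * qpoch q b * qpoch q c * qpoch q N))).
    by rewrite /t; ring.
  by rewrite H /t; ring.
rewrite NE; apply: (mulfI (lt0r_neq0 (subr1X_gt0 N q01))).
rewrite -/N [LHS]mulrA hlawS ?leq_addr //; last by lia.
rewrite (_ : (N.+1 - (k + a) = b + c)%N); last lia.
rewrite qpochS acn qpochS -acn.
transitivity ((1 - q ^+ N.+1) * ((1 - q ^+ a) * q ^+ c * P + (1 - q ^+ c) * P)).
  by rewrite -T1 -T2 /Q; ring.
by rewrite /P exprD; ring.
Qed.

(** * Unimodality and the probability of an event *)

(** Ratio of consecutive probabilities *)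
Lemma hlaw_rec (R : realType) (q : R) k a b c : 0 < q < 1 ->
  let N := (k + a + b + c).+2 in
  hlaw q N (k + b).+1 (k + a).+1 k.+1 *
    (q ^+ (a + b).+1 * (1 - q ^+ k.+1) * (1 - q ^+ c.+1)) =
  hlaw q N (k + b).+1 (k + a).+1 k * ((1 - q ^+ a.+1) * (1 - q ^+ b.+1)).
Proof.
move=> q01 N.
have q0 : 0 < q by case/andP: q01.
have := hlawE k.+1 a b c.+1 q01; have := hlawE k a.+1 b.+1 c q01.
have -> : (k + a.+1 + b.+1 + c = N)%N by rewrite /N; lia.
have -> : (k.+1 + a + b + c.+1 = N)%N by rewrite /N; lia.
rewrite !addnS !addSn => H1 H2; clearbody N.
have Z n : qpoch q n != 0 by exact/lt0r_neq0/qpoch_gt0.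
have {}H1 := congr1 (fun t => t * ((1 - q ^+ k.+1) * (1 - q ^+ c.+1))) H1.
have {}H2 := congr1 (fun t => t *
  (q ^+ (a + b).+1 * (1 - q ^+ a.+1) * (1 - q ^+ b.+1))) H2.
apply: (@mulIf _ (qpoch q k * qpoch q a * qpoch q b * qpoch q c * qpoch q N *
   ((1 - q ^+ k.+1) * (1 - q ^+ c.+1) * (1 - q ^+ a.+1) * (1 - q ^+ b.+1)))).
  by rewrite !mulf_neq0 //; exact/lt0r_neq0/subr1X_gt0.
rewrite !qpochS in H1 H2.
have HX : q ^+ (a.+1 * b.+1) = q ^+ (a * b) * q ^+ (a + b).+1.
  by rewrite -exprD; congr (q ^+ _); lia.
rewrite HX in H1.
transitivity (hlaw q N (k + b).+1 (k + a).+1 k.+1 *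
       (qpoch q k * (1 - q ^+ k.+1) * qpoch q a * qpoch q b *
        (qpoch q c * (1 - q ^+ c.+1)) * qpoch q N) *
       (q ^+ (a + b).+1 * (1 - q ^+ a.+1) * (1 - q ^+ b.+1))
       * ((1 - q ^+ k.+1) * (1 - q ^+ c.+1))); first by ring.
rewrite H2.
transitivity (hlaw q N (k + b).+1 (k + a).+1 k *
       (qpoch q k * (qpoch q a * (1 - q ^+ a.+1)) *
        (qpoch q b * (1 - q ^+ b.+1)) * qpoch q c * qpoch q N) *
       ((1 - q ^+ k.+1) * (1 - q ^+ c.+1)) * ((1 - q ^+ a.+1) * (1 - q ^+ b.+1)));
  last by ring.
by rewrite H1; ring.
Qed.

Lemma mallows_pmf_ge0 (R : realType) (q : R) N (w : 'S_N) : 0 < q < 1 ->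
  0 <= mallows_pmf q w.
Proof.
move=> q01; have /andP[q0 q1] := q01.
apply: mulr_ge0; first by rewrite exprn_ge0 // ltW.
rewrite /mallows_norm big_nat_cond prodr_ge0 // => -[|j]; rewrite // => _.
by rewrite divr_ge0 ?subr1X_ge0 // subr_ge0 ltW.
Qed.

Lemma hlaw_ge0 (R : realType) (q : R) N L K k : 0 < q < 1 -> 0 <= hlaw q N L K k.
Proof. by move=> q01; apply: sumr_ge0 => w _; apply: mallows_pmf_ge0. Qed.

(** With $a$, $b$, $c$ as in [hlawE], the numerator of $1 - P(k+1)/P(k)$ for the
    law $P$ of the height, the exponents being shifted so that a single quantity
    controls the steps on both sides of $k$.  The law is nonincreasing
    from $k$ on where the drift is nonnegative, and nondecreasing up to $k$ where
    it is nonpositive. *)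
Definition drift (R : realType) (q : R) (k a b c : nat) : R :=
  q ^+ (a + b) * ((1 - q ^+ k) * (1 - q ^+ c)) - (1 - q ^+ a) * (1 - q ^+ b).

Lemma subr1X_le (R : realType) (q : R) m n : 0 < q < 1 -> (m <= n)%N ->
  1 - q ^+ m <= 1 - q ^+ n.
Proof.
by move=> /andP[q0 q1] mn; rewrite lerB // ler_wiXn2l // ltW.
Qed.

(** If the drift at $k_0$ is nonnegative, each step of the law beyond $k_0$ is
    downwards, because the ratio of [hlaw_rec] decreases in $k$. *)
Lemma hlaw_le_mode (R : realType) (q : R) k0 a0 b0 c0 k : 0 < q < 1 ->
  0 <= drift q k0 a0 b0 c0 -> (k0 <= k)%N ->
  hlaw q (k0 + a0 + b0 + c0) (k0 + b0) (k0 + a0) k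
    <= hlaw q (k0 + a0 + b0 + c0) (k0 + b0) (k0 + a0) k0.
Proof.
move=> q01 D; have /andP[q0 q1] := q01.
elim: k => [|k IH]; first by rewrite leqn0 => /eqP ->.
rewrite leq_eqVlt => /predU1P[-> //|]; rewrite ltnS => k0k.
apply: le_trans (IH k0k).
have [ka|ka] := leqP (k0 + a0) k.
  by rewrite hlaw_gtK ?hlaw_ge0 // ltnS.
have [kb|kb] := leqP (k0 + b0) k.
  by rewrite hlaw_gtL ?hlaw_ge0 // ltnS.
pose a := (k0 + a0 - k.+1)%N; pose b := (k0 + b0 - k.+1)%N.
pose c := (c0 + (k - k0))%N.
have := hlaw_rec k a b c q01.
have -> : ((k + a + b + c).+2 = k0 + a0 + b0 + c0)%N by rewrite /a /b /c; lia.
have -> : ((k + b).+1 = k0 + b0)%N by rewrite /b; lia.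
have -> : ((k + a).+1 = k0 + a0)%N by rewrite /a; lia.
move=> /= E; set h1 := hlaw _ _ _ _ k.+1; set h0 := hlaw _ _ _ _ k.
have H0 := hlaw_ge0 (k0 + a0 + b0 + c0) (k0 + b0) (k0 + a0) k q01.
have P : 0 < q ^+ (a + b).+1 * (1 - q ^+ k.+1) * (1 - q ^+ c.+1).
  by rewrite !mulr_gt0 ?exprn_gt0 ?subr1X_gt0.
rewrite -(ler_pM2r P) E ler_wpM2l //.
apply: (@le_trans _ _ ((1 - q ^+ a0) * (1 - q ^+ b0))).
  by rewrite ler_pM ?subr1X_ge0 // subr1X_le // /a /b; lia.
move: D; rewrite /drift subr_ge0 => D; apply: le_trans D _.
rewrite -mulrA; apply: ler_pM; rewrite ?exprn_ge0 ?mulr_ge0 ?subr1X_ge0 ?(ltW q0) //.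
  by apply: ler_wiXn2l; rewrite ?ltW // /a /b; lia.
by rewrite ler_pM ?subr1X_ge0 // subr1X_le // /c; lia.
Qed.

Lemma hlaw_ge_mode (R : realType) (q : R) k0 a0 b0 c0 k : 0 < q < 1 ->
  drift q k0 a0 b0 c0 <= 0 -> (k <= k0)%N ->
  hlaw q (k0 + a0 + b0 + c0) (k0 + b0) (k0 + a0) k
    <= hlaw q (k0 + a0 + b0 + c0) (k0 + b0) (k0 + a0) k0.
Proof.
move=> q01 D kk; have /andP[q0 q1] := q01.
rewrite -(subKn kk); elim: (k0 - k)%N => [|j IH]; first by rewrite subn0.
have [jk|jk] := leqP k0 j; first by rewrite (_ : k0 - j.+1 = k0 - j)%N //; lia.
apply: le_trans IH; move iE : (k0 - j.+1)%N => i.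
have -> : (k0 - j = i.+1)%N by lia.
have [ic|ic] := leqP c0 j.
  by rewrite hlaw_lt ?hlaw_ge0 //; lia.
pose a := (k0 + a0 - i.+1)%N; pose b := (k0 + b0 - i.+1)%N.
pose c := (c0 - j.+1)%N.
have := hlaw_rec i a b c q01.
have -> : ((i + a + b + c).+2 = k0 + a0 + b0 + c0)%N by rewrite /a /b /c; lia.
have -> : ((i + b).+1 = k0 + b0)%N by rewrite /b; lia.
have -> : ((i + a).+1 = k0 + a0)%N by rewrite /a; lia.
move=> /= E; set h1 := hlaw _ _ _ _ i.+1; set h0 := hlaw _ _ _ _ i.
have H0 := hlaw_ge0 (k0 + a0 + b0 + c0) (k0 + b0) (k0 + a0) i.+1 q01.
have P : 0 < (1 - q ^+ a.+1) * (1 - q ^+ b.+1).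
  by rewrite !mulr_gt0 ?exprn_gt0 ?subr1X_gt0.
rewrite -(ler_pM2r P) -E ler_wpM2l //.
apply: (@le_trans _ _ ((1 - q ^+ a0) * (1 - q ^+ b0))); last first.
  by rewrite ler_pM ?subr1X_ge0 // subr1X_le // /a /b; lia.
move: D; rewrite /drift subr_le0 => D; apply: le_trans D.
rewrite -mulrA; apply: ler_pM; rewrite ?exprn_ge0 ?mulr_ge0 ?subr1X_ge0 ?(ltW q0) //.
  by apply: ler_wiXn2l; rewrite ?ltW // /a /b; lia.
by rewrite ler_pM ?subr1X_ge0 // subr1X_le // /c; lia.
Qed.

Lemma mallows_height (R : realType) (q : R) N L K (A : pred nat) : (L <= N)%N ->
  mallows q [set w : 'S_N | A (height w L K)]%SET =
  \sum_(k < N.+1 | A k) hlaw q N L K k.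
Proof.
move=> LN; rewrite mallowsE [RHS]big_mkcond /=.
under [RHS]eq_bigr => k _.
  rewrite /hlaw mallowsE (_ : (if _ then _ else _) = \sum_(w : 'S_N)
    (if A k && (height w L K == k) then mallows_pmf q w else 0)); last first.
    by case: (A k) => //=; rewrite big1.
  over.
rewrite exchange_big /=; apply: eq_bigr => w _.
have hN : (height w L K < N.+1)%N by rewrite ltnS (leq_trans (height_leL _ _ _)).
rewrite (bigD1 (Ordinal hN)) //= eqxx andbT big1 ?addr0 // => i.
by rewrite -val_eqE /= eq_sym => /negPf ->; rewrite andbF.
Qed.

Lemma mallows_height_bounds (R : realType) (q : R) N L K (A : pred nat) k0 :
  0 < q < 1 -> (L <= N)%N -> (k0 <= N)%N -> A k0 ->
  (forall k, A k -> hlaw q N L K k <= hlaw q N L K k0) ->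
  hlaw q N L K k0 <= mallows q [set w : 'S_N | A (height w L K)]%SET
    <= N.+1%:R * hlaw q N L K k0.
Proof.
move=> q01 LN kN Ak0 H; rewrite mallows_height //.
have k0N : (k0 < N.+1)%N by [].
apply/andP; split.
  rewrite (bigD1 (Ordinal k0N)) //= lerDl sumr_ge0 // => i _; exact: hlaw_ge0.
apply: (@le_trans _ _ (\sum_(k < N.+1) hlaw q N L K k0)).
  rewrite big_mkcond /=; apply: ler_sum => i _; case: ifP => [/H //|_].
  exact: hlaw_ge0.
by rewrite sumr_const card_ord mulr_natl.
Qed.

(** * Sums of inverse squared sines *)

Lemma sin_le_id (R : realType) (x : R) : 0 <= x -> sin x <= x.
Proof.
move=> x0; have [c _] := @MVT_segment R sin cos 0 x x0
  (fun y _ => is_derive_sin y) (continuous_subspaceT (@continuous_sin R)).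
rewrite sin0 !subr0 => ->.
by rewrite ler_piMl // cos_le1.
Qed.

(** The inequality $x \le \tan x$, without the division *)
Lemma mulr_cos_le_sin (R : realType) (x : R) : 0 <= x <= pi -> x * cos x <= sin x.
Proof.
move=> /andP[x0 xpi].
pose f (y : R) := sin y - y * cos y.
have df (y : R) : is_derive y 1 f (y * sin y).
  apply: is_derive_eq; rewrite /GRing.scale /=; ring.
have cf : {within `[0, x], continuous f}.
  apply: continuous_subspaceT => y; apply: differentiable_continuous.
  by apply/derivable1_diffP; apply: ex_derive.
have [c] := @MVT_segment R f (fun y => y * sin y) 0 x x0 (fun y _ => df y) cf.
rewrite in_itv /= => /andP[c0 cx].
rewrite /f sin0 mul0r subrr !subr0 => E.
rewrite -subr_ge0 E !mulr_ge0 // sin_ge0_pi // c0 /=; exact: le_trans xpi.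
Qed.

Lemma invr_sin2_bounds (R : realType) (x : R) : 0 < x < pi / 2 ->
  x ^- 2 <= sin x ^- 2 <= x ^- 2 + 1.
Proof.
move=> /andP[x0 xpi]; have pi0 := pi_gt0 R.
have s0 : 0 < sin x by rewrite sin_gt0_pihalf // x0.
have c0 : 0 <= cos x by rewrite cos_ge0_pihalf //; apply/andP; split; lra.
apply/andP; split.
  rewrite lef_pV2 ?posrE ?exprn_gt0 // lerXn2r ?nnegrE ?(ltW s0) ?(ltW x0) //.
  by rewrite sin_le_id // ltW.
rewrite -lerBlDr.
have -> : sin x ^- 2 - 1 = (cos x / sin x) ^+ 2.
  by rewrite expr_div_n cos2sin2; field; rewrite gt_eqF.
rewrite -exprVn lerXn2r ?nnegrE ?invr_ge0 ?divr_ge0 ?(ltW s0) ?(ltW x0) //.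
rewrite ler_pdivrMr // mulrC ler_pdivlMr // mulrC.
by rewrite mulr_cos_le_sin // ltW //=; lra.
Qed.

Lemma invr_sin2_half (R : realType) (x : R) : 0 < x < pi / 2 ->
  sin x ^- 2 = (sin (x / 2) ^- 2 + sin (pi / 2 - x / 2) ^- 2) / 4.
Proof.
move=> /andP[x0 xpi]; have pi0 := pi_gt0 R.
have s0 : 0 < sin (x / 2) by rewrite sin_gt0_pihalf //; apply/andP; split; lra.
have c0 : 0 < cos (x / 2) by rewrite cos_gt0_pihalf //; apply/andP; split; lra.
rewrite -(opprB _ (pi / 2)) sinN sinBpihalf opprK.
have {1}-> : x = (x / 2) *+ 2 by rewrite mulr2n; lra.
rewrite sin_mulr2n -[RHS](@mulr1 R).
have := cos2Dsin2 (x / 2); set c := cos _; set s := sin _ => E.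
have -> : (s ^- 2 + c ^- 2) = (c ^+ 2 + s ^+ 2) / (c ^+ 2 * s ^+ 2).
  by field; rewrite !gt_eqF.
by rewrite E; field; rewrite !gt_eqF.
Qed.

(** The odd multiples of $\pi/2^{n+2}$; those with $k < 2^n$ lie between $0$ and
    $\pi/2$. *)
Definition odd_angle (R : realType) (n k : nat) : R :=
  (2 * k + 1)%:R / 2 ^+ n.+2 * pi.

Lemma odd_angle_itv (R : realType) n k : (k < 2 ^ n)%N ->
  0 < odd_angle R n k < pi / 2.
Proof.
move=> kn; have pi0 := pi_gt0 R; rewrite /odd_angle.
have e0 : 0 < 2 ^+ n.+2 :> R by rewrite exprn_gt0.
have k0 : 0 < (2 * k + 1)%:R :> R by rewrite ltr0n addn1.
rewrite mulr_gt0 ?divr_gt0 //= mulrC ltr_pM2l // ltr_pdivrMr //.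
rewrite exprS mulrA mulVf // mul1r.
by rewrite -natrX ltr_nat expnS; lia.
Qed.

(** The angles of level $n + 1$ are the numbers $x/2$ and $\pi/2 - x/2$, for $x$
    among the angles of level $n$. *)
Lemma sum_invr_sin2_odd_angle (R : realType) n :
  \sum_(k < 2 ^ n) sin (odd_angle R n k) ^- 2 = 2 * 4 ^+ n.
Proof.
elim: n => [|n IH].
  rewrite expn0 big_ord1 expr0 mulr1 /odd_angle /= muln0 add0n.
  have -> : 1%:R / 2 ^+ 2 * pi = pi / 4 :> R by field.
  have p0 := pi_gt0 R.
  have E : pi / 4 = pi / 2 - pi / 4 :> R by field.
  have C : sin (pi / 4) = cos (pi / 4) :> R.
    by rewrite {1}E -(opprB _ (pi / 2)) sinN sinBpihalf opprK.
  have := cos2Dsin2 (pi / 4 : R); rewrite -C -mulr2n => H.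
  have s0 : sin (pi / 4) ^+ 2 != 0 :> R.
    by apply/eqP => h; move: H; rewrite h mul0rn => /eqP; rewrite eq_sym oner_eq0.
  by apply: (mulIf s0); rewrite mulVf // mulr_natl H.
transitivity (4 * \sum_(k < 2 ^ n) sin (odd_angle R n k) ^- 2); last first.
  by rewrite IH exprS; ring.
rewrite expnS mul2n -addnn big_split_ord /=.
rewrite [X in _ + X](reindex_inj rev_ord_inj) /= -big_split mulr_sumr /=.
apply: eq_bigr => k _.
rewrite (invr_sin2_half (odd_angle_itv R (ltn_ord k))).
have e0 : 2 ^+ n != 0 :> R by rewrite expf_neq0.
have -> : odd_angle R n.+1 k = odd_angle R n k / 2.
  by rewrite /odd_angle !exprS; field.
have -> : odd_angle R n.+1 (2 ^ n + (2 ^ n - k.+1)) = pi / 2 - odd_angle R n k / 2.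
  have kn := ltn_ord k; rewrite /odd_angle.
  have -> : (2 * (2 ^ n + (2 ^ n - k.+1)) + 1 = 4 * 2 ^ n - (2 * k + 1))%N by lia.
  rewrite natrB; last lia.
  by rewrite natrM natrX !exprS; field.
by rewrite [RHS]mulrC divfK // pnatr_eq0.
Qed.

Lemma cvg_sum_odd_squares (R : realType) :
  (fun n : nat => \sum_(k < 2 ^ n) ((2 * k + 1)%:R ^- 2 : R))
    @ \oo --> (pi ^+ 2 / 8 : R).
Proof.
have p0 := pi_gt0 R.
pose O n : R := \sum_(k < 2 ^ n) ((2 * k + 1)%:R ^- 2).
have E n : \sum_(k < 2 ^ n) (odd_angle R n k) ^- 2 = 16 * 4 ^+ n / pi ^+ 2 * O n.
  rewrite /O mulr_sumr; apply: eq_bigr => k _; rewrite /odd_angle.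
  have k0 : (2 * k + 1)%:R != 0 :> R by rewrite pnatr_eq0 addn1.
  have -> : 4 ^+ n = 2 ^+ n * 2 ^+ n :> R.
    by rewrite -exprMn; congr (_ ^+ n); ring.
  have e0 : 2 ^+ n != 0 :> R by rewrite expf_neq0.
  move: (2 * k + 1)%:R k0 (pi : R) p0 => m m0 p p0.
  by rewrite !exprS; field; rewrite m0 e0 gt_eqF.
have B n : pi ^+ 2 / 8 - pi ^+ 2 / 16 * 2 ^- n <= O n <= pi ^+ 2 / 8.
  have f0 : 0 < 4 ^+ n :> R by rewrite exprn_gt0.
  have p20 : 0 < pi ^+ 2 :> R by rewrite exprn_gt0.
  have c0 : 0 < 16 * 4 ^+ n / pi ^+ 2 :> R by rewrite divr_gt0 // mulr_gt0.
  have L1 : \sum_(k < 2 ^ n) (odd_angle R n k) ^- 2 <= 2 * 4 ^+ n.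
    rewrite -sum_invr_sin2_odd_angle; apply: ler_sum => k _.
    by have /andP[] := invr_sin2_bounds (odd_angle_itv R (ltn_ord k)).
  have L2 : 2 * 4 ^+ n <= \sum_(k < 2 ^ n) (odd_angle R n k) ^- 2 + 2 ^+ n.
    rewrite -sum_invr_sin2_odd_angle.
    have -> : 2 ^+ n = \sum_(k < 2 ^ n) 1 :> R.
      by rewrite sumr_const card_ord -natrX.
    rewrite -big_split; apply: ler_sum => k _ /=.
    by have /andP[] := invr_sin2_bounds (odd_angle_itv R (ltn_ord k)).
  rewrite E in L1 L2; move: (pi : R) p0 p20 c0 L1 L2 => p p0 p20 c0 L1 L2.
  apply/andP; split; rewrite -(ler_pM2l c0).
    apply: (@le_trans _ _ (2 * 4 ^+ n - 2 ^+ n)); last by rewrite lerBlDr.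
    rewrite le_eqVlt; apply/orP; left; apply/eqP.
    have -> : 4 ^+ n = 2 ^+ n * 2 ^+ n :> R.
      by rewrite -exprMn; congr (_ ^+ n); ring.
    have e0 : 2 ^+ n != 0 :> R by rewrite expf_neq0.
    by field; rewrite e0 gt_eqF.
  apply: (le_trans L1); rewrite le_eqVlt; apply/orP; left; apply/eqP.
  by field; rewrite gt_eqF.
apply: (@squeeze_cvgr _ _ _ _ (fun n => pi ^+ 2 / 8 - pi ^+ 2 / 16 * 2 ^- n)
  (fun=> pi ^+ 2 / 8)); first by apply: nearW => n; apply: B.
- rewrite -[X in _ --> X]subr0; apply: cvgB; first exact: cvg_cst.
  rewrite -[X in _ --> X](mulr0 (pi ^+ 2 / 16)); apply: cvgM; first exact: cvg_cst.
  under eq_fun do rewrite -exprVn.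
  apply: cvg_expr; rewrite ger0_norm ?invr_ge0 // invf_lt1 //; lra.
- exact: cvg_cst.
Qed.

(** * The dilogarithm and the logarithmic series *)

Lemma li2_term_ge0 (R : realType) (z : R) n : 0 <= z ->
  0 <= z ^+ n.+1 / n.+1%:R ^+ 2.
Proof. by move=> z0; rewrite divr_ge0 ?exprn_ge0. Qed.

Lemma sum_invr_squares_le (R : realType) m n : (0 < m <= n)%N ->
  \sum_(m <= k < n) (k.+1%:R ^- 2 : R) <= m%:R^-1 - n%:R^-1.
Proof.
move=> /andP[m0]; elim: n => [|n IH].
  by rewrite leqn0 => /eqP ->; rewrite big_geq // subrr.
rewrite leq_eqVlt => /predU1P[->|]; first by rewrite big_geq // subrr.
rewrite ltnS => mn; rewrite big_nat_recr //=.
apply: le_trans (lerD (IH mn) (lexx _)) _.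
have n0 : 0 < n%:R :> R by rewrite ltr0n (leq_trans m0).
rewrite -natr1; move: (n%:R : R) n0 => x x0.
rewrite -subr_ge0.
have -> : m%:R^-1 - (x + 1)^-1 - (m%:R^-1 - x^-1 + (x + 1) ^- 2)
  = (x * (x + 1) ^+ 2)^-1.
  move: (m%:R^-1) => y; field; rewrite !gt_eqF //; lra.
by rewrite invr_ge0 mulr_ge0 ?exprn_ge0 //; lra.
Qed.

(** The tail of the dilogarithm series from rank $m$ on is at most $1/m$,
    uniformly in $z \in [0, 1]$. *)
Lemma li2_sum_tail (R : realType) (z : R) m n : 0 <= z <= 1 -> (0 < m <= n)%N ->
  \sum_(0 <= k < n) z ^+ k.+1 / k.+1%:R ^+ 2
    <= \sum_(0 <= k < m) z ^+ k.+1 / k.+1%:R ^+ 2 + m%:R^-1.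
Proof.
move=> /andP[z0 z1] mn; have /andP[_ mn'] := mn.
rewrite (big_cat_nat (n := m)) //= lerD2l.
apply: (@le_trans _ _ (\sum_(m <= k < n) (k.+1%:R ^- 2 : R))).
  by apply: ler_sum => k _; rewrite ler_piMl ?invr_ge0 ?exprn_ge0 // exprn_ile1.
apply: le_trans (sum_invr_squares_le R mn) _.
by rewrite gerBl invr_ge0.
Qed.

Lemma cvg_Li2 (R : realType) (z : R) : 0 <= z <= 1 ->
  (fun n => \sum_(0 <= k < n) z ^+ k.+1 / k.+1%:R ^+ 2) @ \oo --> Li2 z.
Proof.
move=> z01; have /andP[z0 z1] := z01.
suff : cvgn (series (fun n : nat => z ^+ n.+1 / n.+1%:R ^+ 2)) by [].
apply: nondecreasing_is_cvgn.
  by apply: nondecreasing_series => n _ _; apply: li2_term_ge0.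
exists (\sum_(0 <= k < 1) z ^+ k.+1 / k.+1%:R ^+ 2 + 1%:R^-1) => _ [n _ <-] /=.
have [->|n0] := posnP n.
  rewrite seriesEnat /= big_geq // addr_ge0 // sumr_ge0 // => i _.
  exact: li2_term_ge0.
by rewrite seriesEnat /=; apply: li2_sum_tail.
Qed.

Lemma Li2_bounds (R : realType) (z : R) m : 0 <= z <= 1 -> (0 < m)%N ->
  \sum_(0 <= k < m) z ^+ k.+1 / k.+1%:R ^+ 2 <= Li2 z
    <= \sum_(0 <= k < m) z ^+ k.+1 / k.+1%:R ^+ 2 + m%:R^-1.
Proof.
move=> z01 m0; have C := cvg_Li2 z01; have /andP[z0 z1] := z01; apply/andP; split.
  apply: (cvgr_to_ge C); near=> n.
  rewrite [leRHS](big_cat_nat (n := m)) //=; last by near: n; exact: nbhs_infty_ge.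
  by rewrite lerDl sumr_ge0 // => i _; exact: li2_term_ge0.
apply: (cvgr_to_le C); near=> n; apply: li2_sum_tail => //; rewrite m0.
near: n; exact: nbhs_infty_ge.
Unshelve. all: by end_near. Qed.

(** The even terms of the series make up a quarter of its sum, so the odd terms
    make up three quarters. *)
Lemma Li2_1 (R : realType) : Li2 1 = pi ^+ 2 / 6 :> R.
Proof.
pose Z n : R := \sum_(0 <= k < n) 1 ^+ k.+1 / k.+1%:R ^+ 2.
have ZC : Z @ \oo --> Li2 (1 : R) by apply: cvg_Li2; rewrite ler01 lexx.
have oo : (fun n => 2 ^ n)%N @ \oo --> \oo.
  apply/cvgnyPge => A; near=> n; apply: (@leq_trans n).
    by near: n; exact: nbhs_infty_ge.
  by rewrite ltnW // ltn_expl.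
have ZE n : Z (n.*2) = \sum_(k < n) ((2 * k + 1)%:R ^- 2 : R) + Z n / 4.
  elim: n => [|n IH]; first by rewrite /Z /= big_ord0 !big_geq // mul0r addr0.
  rewrite doubleS /Z !big_nat_recr //= -/(Z _) -/(Z _) IH big_ord_recr /= !expr1n.
  have -> : (2 * n + 1 = n.*2.+1)%N by lia.
  have -> : n.*2.+2%:R = 2 * n.+1%:R :> R by rewrite -natrM; congr _%:R; lia.
  have n0 : n.+1%:R != 0 :> R by rewrite pnatr_eq0.
  rewrite -!exprVn invfM exprMn; move: (n.+1%:R^-1) (n.*2.+1%:R^-1) => u v.
  by field.
have Z2 : (fun n => Z (2 ^ n)%N) @ \oo --> Li2 (1 : R).
  exact: (cvg_comp _ _ oo ZC).
have Z3 : (fun n => Z ((2 ^ n).*2)%N) @ \oo --> Li2 (1 : R).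
  under eq_fun do rewrite -mul2n -expnS.
  by move: Z2; rewrite -(cvg_shiftS (fun n => Z (2 ^ n)%N)).
have Z4 : (fun n => Z ((2 ^ n).*2)%N) @ \oo --> (pi ^+ 2 / 8 + Li2 1 / 4 : R).
  under eq_fun do rewrite ZE.
  apply: cvgD; first exact: cvg_sum_odd_squares.
  by apply: cvgM; [exact: Z2|exact: cvg_cst].
have h : Li2 1 = pi ^+ 2 / 8 + Li2 1 / 4 :> R by apply: cvg_unique Z3 Z4.
move: (pi : R) (Li2 _) h => p L h.
lra.
Unshelve. all: by end_near. Qed.

Lemma is_derive_log_sum (R : realType) M (t : R) :
  is_derive t 1 (fun s : R => \sum_(0 <= k < M) s ^+ k.+1 / k.+1%:R)
    (\sum_(0 <= k < M) t ^+ k).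
Proof.
elim: M => [|M IH].
  have -> : (fun s : R => \sum_(0 <= k < 0) s ^+ k.+1 / k.+1%:R) = cst 0.
    by apply/funext => s; rewrite big_geq.
  by rewrite big_geq //; exact: is_derive_cst.
have -> : (fun s : R => \sum_(0 <= k < M.+1) s ^+ k.+1 / k.+1%:R) =
  (fun s : R => \sum_(0 <= k < M) s ^+ k.+1 / k.+1%:R)
   + (M.+1%:R^-1 \*: ((@id R) ^+ M.+1)).
  apply/funext => s; rewrite big_nat_recr //=.
  rewrite [X in _ + X]mulrC; congr (_ + _ * _).
  by rewrite exprfctE.
rewrite big_nat_recr //=; apply: is_derive_eq.
by congr (_ + _); rewrite /GRing.scale /= mulr1 mulrA mulVf ?mul1r //.
Qed.

(** Remainder of the logarithmic series: the derivative of the middle term in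
    $x$ is $x^M / (1 - x)$. *)
Lemma ln1B_bounds (R : realType) (x : R) M : 0 <= x < 1 ->
  0 <= - ln (1 - x) - \sum_(0 <= k < M) x ^+ k.+1 / k.+1%:R
    <= x ^+ M.+1 / (1 - x).
Proof.
move=> /andP[x0 x1].
pose f (t : R) := - ln (1 - t) - \sum_(0 <= k < M) t ^+ k.+1 / k.+1%:R.
have df (t : R) : t < 1 -> is_derive t 1 f (t ^+ M / (1 - t)).
  move=> t1.
  have d1 : is_derive t 1 (fun s : R => ln (1 - s)) (- (1 - t)^-1).
    have := @is_derive1_comp R (@ln R) (fun s : R => 1 - s) t (1 - t)^-1 (-1).
    rewrite mulrN1; apply; first by apply: is_derive1_ln; rewrite subr_gt0.
    by apply: is_derive_eq; rewrite add0r mul1r.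
  have d2 := is_derive_log_sum M t.
  have d3 : is_derive t 1 f (- - (1 - t)^-1 - \sum_(0 <= k < M) t ^+ k).
    exact: is_deriveB (is_deriveN d1) d2.
  apply: is_derive_eq d3 _; rewrite opprK.
  apply: (@mulIf _ (1 - t)); first by rewrite gt_eqF // subr_gt0.
  rewrite mulrBl mulVf ?gt_eqF ?subr_gt0 // divfK ?gt_eqF ?subr_gt0 //.
  have -> : (\sum_(0 <= k < M) t ^+ k) * (1 - t) = 1 - t ^+ M.
    rewrite big_mkord; have := subrXX 1 t M; rewrite expr1n => ->.
    by rewrite mulrC; congr (_ * _); apply: eq_bigr => i _; rewrite expr1n mul1r.
  by rewrite opprB addrC subrK.
have cf : {within `[0, x], continuous f}.
  apply: derivable_within_continuous => t; rewrite in_itv /= => /andP[_ tx].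
  by have := df t (le_lt_trans tx x1) => ?; apply: ex_derive.
have df' t : t \in `]0, x[%R -> is_derive t 1 f (t ^+ M / (1 - t)).
  by rewrite in_itv /= => /andP[_ tx]; apply: df; apply: lt_trans tx x1.
have [c] := @MVT_segment R f (fun t => t ^+ M / (1 - t)) 0 x x0 df' cf.
rewrite in_itv /= => /andP[c0 cx].
have -> : f 0 = 0.
  rewrite /f subr0 ln1 oppr0 big1 ?subr0 // => i _.
  by rewrite expr0n mul0r.
rewrite !subr0 -/(f x) => ->.
have c1 : 0 < 1 - c by rewrite subr_gt0 (le_lt_trans cx).
rewrite mulr_ge0 ?divr_ge0 ?exprn_ge0 ?(ltW c1) //=.
rewrite exprS mulrC -mulrA ler_wpM2l // ler_pM ?exprn_ge0 ?invr_ge0 ?(ltW c1) //.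
  by rewrite lerXn2r.
by rewrite lef_pV2 ?posrE ?subr_gt0 ?(le_lt_trans cx) // lerD2l lerN2.
Qed.

(** * Expansion of the logarithm of the Pochhammer symbol *)

(** Partial sums of the expansion of $-\ln (q;q)_m$ obtained by summing the
    logarithmic series over the factors of $(q;q)_m$. *)
Definition qpoch_log_sum (R : realType) (q : R) (m n : nat) : R :=
  \sum_(0 <= k < n) q ^+ k.+1 * (1 - (q ^+ m) ^+ k.+1)
                     / (k.+1%:R * (1 - q ^+ k.+1)).

Lemma qpoch_log_sumE (R : realType) (q : R) m n : 0 < q < 1 ->
  qpoch_log_sum q m n =
  \sum_(j < m) \sum_(0 <= k < n) (q ^+ j.+1) ^+ k.+1 / k.+1%:R.
Proof.
move=> q01; rewrite exchange_big /=; apply: eq_bigr => k _.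
rewrite -mulr_suml invfM mulrA [RHS]mulrC -mulrA mulrCA; congr (_ * _).
rewrite -exprM mulnC exprM; under eq_bigr do rewrite -exprM mulnC exprM.
have := subr1X_gt0 k q01; move: (q ^+ k.+1) => x x1.
apply: (canLR (mulfK (lt0r_neq0 x1))).
have := subrXX 1 x m; rewrite expr1n => ->.
rewrite mulrCA mulrC; congr (_ * _); rewrite mulr_sumr /=; apply: eq_bigr => i _.
by rewrite expr1n mul1r exprS.
Qed.

(** As $(k+1) (1-q) q^{k+1} \le 1 - q^{k+1}$, the terms are dominated by
    $(1-q)^{-1} (k+1)^{-2}$, uniformly in $m$. *)
Lemma qpoch_log_sum_tail (R : realType) (q : R) m n n' : 0 < q < 1 ->
  (0 < n <= n')%N ->
  qpoch_log_sum q m n <= qpoch_log_sum q m n'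
    <= qpoch_log_sum q m n + (n%:R * (1 - q))^-1.
Proof.
move=> q01 nn; have /andP[q0 q1] := q01; have /andP[n0 nn'] := nn.
have q1' : 0 < 1 - q by rewrite subr_gt0.
have P k : 0 < 1 - q ^+ k.+1 by exact: subr1X_gt0.
have Q k : 0 <= q ^+ k.+1 by rewrite exprn_ge0 // ltW.
have qm : 0 <= q ^+ m <= 1 by rewrite exprn_ge0 ?exprn_ile1 // ltW.
have T k : 0 <= 1 - (q ^+ m) ^+ k.+1 <= 1.
  have /andP[? ?] := qm.
  by rewrite subr_ge0 exprn_ile1 //= gerBl exprn_ge0.
rewrite {2 3}/qpoch_log_sum (big_cat_nat (n := n)) //=; apply/andP; split.
  rewrite lerDl sumr_ge0 // => k _; have /andP[t0 _] := T k.
  by rewrite divr_ge0 ?mulr_ge0 // ltW.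
rewrite lerD2l invfM.
apply: (@le_trans _ _ (\sum_(n <= k < n') (k.+1%:R ^- 2 : R) * (1 - q)^-1)).
  apply: ler_sum => k _; have /andP[t0 t1] := T k.
  have k0 : 0 < k.+1%:R :> R by rewrite ltr0n.
  rewrite ler_pdivrMr ?mulr_gt0 //.
  have -> : k.+1%:R ^- 2 / (1 - q) * (k.+1%:R * (1 - q ^+ k.+1))
     = (1 - q ^+ k.+1) / (1 - q) / k.+1%:R by field; rewrite !gt_eqF.
  rewrite ler_pdivlMr //.
  have -> : (1 - q ^+ k.+1) / (1 - q) = \sum_(i < k.+1) q ^+ i.
    apply: (canLR (mulfK (lt0r_neq0 q1'))).
    have := subrXX 1 q k.+1; rewrite expr1n => ->; rewrite mulrC; congr (_ * _).
    by apply: eq_bigr => i _; rewrite expr1n mul1r.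
  apply: (@le_trans _ _ (q ^+ k.+1 * k.+1%:R)).
    by rewrite ler_wpM2r // ler_piMr.
  rewrite mulr_natr -[X in _ *+ X](card_ord k.+1) -sumr_const.
  by apply: ler_sum => i _; rewrite ler_wiXn2l ?(ltW q0) ?(ltW q1) // ltnW.
rewrite -mulr_suml ler_wpM2r ?invr_ge0 ?(ltW q1') //.
apply: le_trans (sum_invr_squares_le R nn) _.
by rewrite gerBl invr_ge0.
Qed.

Lemma ln_qpoch_bounds (R : realType) (q : R) m n : 0 < q < 1 -> (0 < n)%N ->
  qpoch_log_sum q m n <= - ln (qpoch q m)
    <= qpoch_log_sum q m n + (n%:R * (1 - q))^-1.
Proof.
move=> q01 n0; have /andP[q0 q1] := q01.
have E : - ln (qpoch q m) = \sum_(j < m) - ln (1 - q ^+ j.+1).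
  elim: m => [|m IH]; first by rewrite qpoch0 ln1 oppr0 big_ord0.
  rewrite qpochS lnM ?posrE ?qpoch_gt0 ?subr1X_gt0 // opprD IH.
  by rewrite big_ord_recr.
have B k : qpoch_log_sum q m k <= - ln (qpoch q m)
    <= qpoch_log_sum q m k + q ^+ k * (m%:R / (1 - q)).
  rewrite qpoch_log_sumE // E.
  have J (j : 'I_m) := @ln1B_bounds R (q ^+ j.+1) k.
  have J1 (j : 'I_m) : 0 <= q ^+ j.+1 < 1.
    by rewrite exprn_ge0 ?exprn_ilt1 // ltW.
  apply/andP; split.
    apply: ler_sum => j _; have /andP[+ _] := J j (J1 j).
    by rewrite subr_ge0.
  rewrite -lerBlDl -sumrB.
  have -> : q ^+ k * (m%:R / (1 - q)) = \sum_(j < m) q ^+ k / (1 - q).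
    by rewrite sumr_const card_ord -[RHS]mulr_natr -mulrA [_^-1 * _]mulrC.
  apply: ler_sum => j _; have /andP[_ +] := J j (J1 j); move=> /le_trans; apply.
  rewrite ler_pM ?exprn_ge0 ?invr_ge0 ?subr1X_ge0 ?(ltW q0) //.
    rewrite -exprM ler_wiXn2l ?(ltW q0) ?(ltW q1) //; nia.
  rewrite lef_pV2 ?posrE ?subr1X_gt0 // ?subr_gt0 // lerD2l lerN2.
  by rewrite exprS ler_piMr ?(ltW q0) // exprn_ile1 ?(ltW q0) ?(ltW q1).
apply/andP; split; first by have /andP[] := B n.
have C : (fun k => qpoch_log_sum q m n + (n%:R * (1 - q))^-1
     + q ^+ k * (m%:R / (1 - q))) @ \oo -->
   (qpoch_log_sum q m n + (n%:R * (1 - q))^-1 + 0 * (m%:R / (1 - q))).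
  apply: cvgD; first exact: cvg_cst.
  apply: cvgM; last exact: cvg_cst.
  by apply: cvg_expr; rewrite ger0_norm // ltW.
rewrite mul0r addr0 in C; apply: (cvgr_to_ge C); near=> k.
have /andP[_ /le_trans] := B k; apply; rewrite lerD2r.
have nk : (0 < n <= k)%N by rewrite n0; near: k; exact: nbhs_infty_ge.
by have /andP[] := qpoch_log_sum_tail m q01 nk.
Unshelve. all: by end_near. Qed.

(** The parameter $q = 1 - \beta/N$ *)
Definition qN (R : realType) (beta : R) (N : nat) : R := 1 - beta / N%:R.

Lemma qN_itv (R : realType) (beta : R) : 0 < beta ->
  \forall N \near \oo, 0 < qN beta N < 1.
Proof.
move=> b0; near=> N.
have N0 : 0 < N%:R :> R by rewrite ltr0n; near: N; exact: nbhs_infty_gt.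
rewrite /qN subr_gt0 ltr_pdivrMr // mul1r gtrBl divr_gt0 // andbT.
near: N; exact: nbhs_infty_gtr.
Unshelve. all: by end_near. Qed.

Lemma cvg_invn (R : realType) : (fun N : nat => (N%:R : R)^-1) @ \oo --> (0 : R).
Proof.
by rewrite -(cvg_shiftS (fun N : nat => (N%:R : R)^-1)); exact: cvg_harmonic.
Qed.

Lemma cvg_qN (R : realType) (beta : R) : qN beta @ \oo --> (1 : R).
Proof.
rewrite -[X in _ --> X]subr0; apply: cvgB; first exact: cvg_cst.
rewrite -[X in _ --> X](mulr0 beta); apply: cvgM; first exact: cvg_cst.
exact: cvg_invn.
Qed.

Lemma cvg_ln_qN (R : realType) (beta : R) : 0 < beta ->
  (fun N : nat => N%:R * ln (qN beta N)) @ \oo --> - beta.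
Proof.
move=> b0.
(* $-t/(1-t) \le \ln (1-t) \le -t$ for $t = \beta/N$ *)
apply: (@squeeze_cvgr _ _ _ _ (fun N => - beta / qN beta N) (fun=> - beta)).
- near=> N.
  have /andP[q0 q1] : 0 < qN beta N < 1 by near: N; exact: qN_itv.
  have N0 : 0 < N%:R :> R by rewrite ltr0n; near: N; exact: nbhs_infty_gt.
  have E : beta = N%:R * (1 - qN beta N) by rewrite /qN; field; rewrite gt_eqF.
  apply/andP; split.
    rewrite {1}E mulNr -mulrA -mulrN ler_pM2l //.
    have := @le_ln1Dx R ((qN beta N)^-1 - 1).
    rewrite [1 + _]addrC subrK lnV ?posrE // => H.
    rewrite -lerN2 opprK; apply: le_trans (H _) _; last first.
      by rewrite mulrBl mul1r divff ?gt_eqF.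
    by rewrite ltrBrDl subrr invr_gt0.
  rewrite {2}E -mulrN ler_pM2l //.
  have := @le_ln1Dx R (qN beta N - 1); rewrite [1 + _]addrC subrK opprB; apply.
  by rewrite ltrBrDl subrr.
- rewrite -[X in _ --> X]mulr1; apply: cvgM; first exact: cvg_cst.
  rewrite -[X in _ --> X]invr1; apply: cvgV; [exact: oner_neq0|exact: cvg_qN].
- exact: cvg_cst.
Unshelve. all: by end_near. Qed.

Lemma cvg_qN_expr (R : realType) (beta a : R) (m : nat -> nat) : 0 < beta ->
  (fun N => (m N)%:R / N%:R) @ \oo --> a ->
  (fun N => qN beta N ^+ m N) @ \oo --> expR (- (beta * a)).
Proof.
move=> b0 ma.
have C : (fun N => expR (((m N)%:R / N%:R) * (N%:R * ln (qN beta N)))) @ \oo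
    --> expR (- (beta * a)).
  apply: continuous_cvg; first exact: continuous_expR.
  rewrite mulrC -mulrN; apply: cvgM => //; exact: cvg_ln_qN.
apply: cvg_trans C; apply: near_eq_cvg; near=> N.
have /andP[q0 q1] : 0 < qN beta N < 1 by near: N; exact: qN_itv.
have N0 : 0 < N%:R :> R by rewrite ltr0n; near: N; exact: nbhs_infty_gt.
rewrite mulrA divfK ?gt_eqF // expRM_natl lnK ?posrE //.
Unshelve. all: by end_near. Qed.

(** Term by term limit, at a fixed number $n$ of terms *)
Lemma cvg_qpoch_log_sum (R : realType) (beta a : R) (m : nat -> nat) n :
  0 < beta -> (fun N => (m N)%:R / N%:R) @ \oo --> a ->
  (fun N => N%:R^-1 * qpoch_log_sum (qN beta N) (m N) n) @ \oo -->
  beta^-1 * (\sum_(0 <= k < n) 1 ^+ k.+1 / k.+1%:R ^+ 2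
    - \sum_(0 <= k < n) expR (- (beta * a)) ^+ k.+1 / k.+1%:R ^+ 2).
Proof.
move=> b0 ma; elim: n => [|n IH].
  rewrite !big_geq // subrr mulr0.
  under eq_fun do rewrite /qpoch_log_sum big_geq // mulr0.
  exact: cvg_cst.
under eq_fun do rewrite /qpoch_log_sum big_nat_recr //= mulrDr.
rewrite !big_nat_recr //= opprD addrACA mulrDr; apply: cvgD; first exact: IH.
have XC (f : nat -> R) (l : R) k : f @ \oo --> l ->
    (fun N => f N ^+ k) @ \oo --> l ^+ k.
  exact: (@continuous_cvg _ _ _ _ _ f (fun x : R => x ^+ k) l
    (@exprn_continuous R k l)).
set e := expR _.
have n0 : n.+1%:R != 0 :> R by rewrite pnatr_eq0.
have C : (fun N => qN beta N ^+ n.+1 * (1 - (qN beta N ^+ m N) ^+ n.+1)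
     / (n.+1%:R * (beta * \sum_(i < n.+1) qN beta N ^+ i))) @ \oo -->
   1 ^+ n.+1 * (1 - e ^+ n.+1) / (n.+1%:R * (beta * \sum_(i < n.+1) 1 ^+ i)).
  apply: cvgM.
    apply: cvgM; first exact/XC/cvg_qN.
    apply: cvgB; first exact: cvg_cst.
    by apply: XC; exact: cvg_qN_expr.
  apply: cvgV.
    under eq_bigr do rewrite expr1n.
    by rewrite sumr_const card_ord !mulf_neq0 // gt_eqF.
  apply: cvgM; first exact: cvg_cst.
  apply: cvgM; first exact: cvg_cst.
  apply: cvg_big; first exact: add_continuous.
  by move=> i _; exact/XC/cvg_qN.
have -> : beta^-1 * (1 ^+ n.+1 / n.+1%:R ^+ 2 - e ^+ n.+1 / n.+1%:R ^+ 2) =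
   1 ^+ n.+1 * (1 - e ^+ n.+1) / (n.+1%:R * (beta * \sum_(i < n.+1) 1 ^+ i)).
  under eq_bigr do rewrite expr1n.
  rewrite sumr_const card_ord expr1n; move: (e ^+ n.+1) => u.
  by move: (n.+1%:R : R) n0 => d d0; field; rewrite d0 gt_eqF.
apply: cvg_trans C; apply: near_eq_cvg; near=> N.
have N0 : 0 < N%:R :> R by rewrite ltr0n; near: N; exact: nbhs_infty_gt.
have : beta = N%:R * (1 - qN beta N) by rewrite /qN; field; rewrite gt_eqF.
move: (qN beta N) => q bE; rewrite bE.
have := subrXX 1 q n.+1; rewrite expr1n.
under eq_bigr do rewrite expr1n mul1r.
by move=> ->; rewrite !invfM; ring.
Unshelve. all: by end_near. Qed.

(** * Exponential rates *)

Lemma expR_itv (R : realType) (t : R) : 0 <= t -> 0 <= expR (- t) <= 1.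
Proof. by move=> t0; rewrite expR_ge0 expR_le1 oppr_le0. Qed.

(** Exponential rate of the Pochhammer symbol: the tails of the expansion being
    uniformly small, the limit may be taken term by term. *)
Lemma cvg_ln_qpoch (R : realType) (beta a : R) (m : nat -> nat) :
  0 < beta -> 0 <= a -> (fun N => (m N)%:R / N%:R) @ \oo --> a ->
  (fun N => N%:R^-1 * ln (qpoch (qN beta N) (m N))) @ \oo -->
  beta^-1 * (Li2 (expR (- (beta * a))) - Li2 1).
Proof.
move=> b0 a0 ma; apply/cvgrPdist_le => e e0.
(* With this many terms, the tail of the expansion and those of the two
   dilogarithm series contribute at most $1/(\beta n)$ each. *)
have [n n0 ne] : exists2 n : nat, (0 < n)%N & 3 / (beta * n%:R) <= e / 2.
  have : \forall n \near \oo, (0 < n)%N /\ 6 / (beta * e) <= n%:R.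
    near=> n; split; first by near: n; exact: nbhs_infty_gt.
    by near: n; exact: nbhs_infty_ger.
  case=> N0 _ /(_ N0 (leqnn _))[N1 N2]; exists N0 => //.
  have N3 : 0 < N0%:R :> R by rewrite ltr0n.
  rewrite ler_pdivrMr ?mulr_gt0 //; move: N2.
  rewrite ler_pdivrMr ?mulr_gt0 //; nra.
have e2 : 0 < e / 2 by rewrite divr_gt0.
have /cvgrPdist_le/(_ (e / 2) e2) C0 := @cvg_qpoch_log_sum R beta a m n b0 ma.
have [B1 B2] : _ /\ _ := conj (@Li2_bounds R 1 n ltac:(by rewrite ler01 lexx) n0)
  (@Li2_bounds R _ n (expR_itv (mulr_ge0 (ltW b0) a0)) n0).
near=> N.
have N0 : 0 < N%:R :> R by rewrite ltr0n; near: N; exact: nbhs_infty_gt.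
have q01 : 0 < qN beta N < 1 by near: N; exact: qN_itv.
have C : `|beta^-1 * (\sum_(0 <= k < n) 1 ^+ k.+1 / k.+1%:R ^+ 2
    - \sum_(0 <= k < n) expR (- (beta * a)) ^+ k.+1 / k.+1%:R ^+ 2)
     - N%:R^-1 * qpoch_log_sum (qN beta N) (m N) n| <= e / 2.
  by near: N; exact: C0.
have := ln_qpoch_bounds (m N) q01 n0.
have -> : (n%:R * (1 - qN beta N))^-1 = N%:R * (beta * n%:R)^-1.
  by rewrite /qN; field; rewrite !gt_eqF // ltr0n.
move: B1 B2 C ne; set S := qpoch_log_sum _ _ _; set l := ln _.
move: (\sum_(0 <= k < n) _) (\sum_(0 <= k < n) _) (Li2 _) (Li2 _) => P1 Pe L1 Le.
have t0 : 0 < (n%:R : R)^-1 by rewrite invr_gt0 ltr0n.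
rewrite !invfM; move: (n%:R^-1 : R) t0 => t t0.
have b1 : 0 < beta^-1 by rewrite invr_gt0.
have N1 : 0 < (N%:R : R)^-1 by rewrite invr_gt0.
move: (beta^-1) b1 => b b1 /andP[A1 A2] /andP[A3 A4] C ne /andP[D1 D2].
have {}D1 : N%:R^-1 * S <= - (N%:R^-1 * l) by rewrite -mulrN ler_pM2l.
have {}D2 : - (N%:R^-1 * l) <= N%:R^-1 * S + b * t.
  have := D2; rewrite -(ler_pM2l N1) mulrDr mulrN mulrA => /le_trans; apply.
  by rewrite mulrA mulVf ?mul1r // gt_eqF.
move: (N%:R^-1 * S) (N%:R^-1 * l) C D1 D2 => s u.
rewrite !ler_norml => /andP[C1 C2] D1 D2.
have F1 : b * Pe <= b * Le by rewrite ler_pM2l.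
have F2 : b * Le <= b * Pe + b * t by rewrite -mulrDr ler_pM2l.
have F3 : b * P1 <= b * L1 by rewrite ler_pM2l.
have F4 : b * L1 <= b * P1 + b * t by rewrite -mulrDr ler_pM2l.
rewrite !mulrBr in C1 C2 *; have bt : 0 < b * t by rewrite mulr_gt0.
by apply/andP; split; lra.
Unshelve. all: by end_near. Qed.

Lemma cvg_truncn (R : realType) (x : R) : 0 <= x ->
  (fun N : nat => (Num.truncn (x * N%:R))%:R / N%:R) @ \oo --> x.
Proof.
move=> x0.
apply: (@squeeze_cvgr _ _ _ _ (fun N => x - N%:R^-1) (fun=> x)).
- near=> N.
  have N0 : 0 < N%:R :> R by rewrite ltr0n; near: N; exact: nbhs_infty_gt.
  have /andP[T1 T2] := truncn_itv (mulr_ge0 x0 (ltW N0)).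
  rewrite ler_pdivrMr // T1 andbT ler_pdivlMr // mulrBl mulVf ?gt_eqF //.
  by rewrite lerBlDr natr1 ltW.
- rewrite -[X in _ --> X]subr0; apply: cvgB; first exact: cvg_cst.
  exact: cvg_invn.
- exact: cvg_cst.
Unshelve. all: by end_near. Qed.

(** Exponential rate of a point probability of the height, when the four
    quadrants contain asymptotically fixed proportions of the points *)
Lemma cvg_ln_hlaw (R : realType) (beta : R) (k a b c : nat -> nat)
    (kl al bl cl : R) : 0 < beta ->
  0 <= kl -> 0 <= al -> 0 <= bl -> 0 <= cl -> kl + al + bl + cl = 1 ->
  (forall N, k N + a N + b N + c N = N)%N ->
  (fun N => (k N)%:R / N%:R) @ \oo --> kl ->
  (fun N => (a N)%:R / N%:R) @ \oo --> al ->
  (fun N => (b N)%:R / N%:R) @ \oo --> bl ->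
  (fun N => (c N)%:R / N%:R) @ \oo --> cl ->
  (fun N => N%:R^-1 * ln (hlaw (qN beta N) N (k N + b N) (k N + a N) (k N))) @ \oo
   --> - (beta^-1 * (beta ^+ 2 * bl * al - Li2 1
      + Li2 (expR (- (beta * kl))) + Li2 (expR (- (beta * bl)))
      + Li2 (expR (- (beta * al))) + Li2 (expR (- (beta * cl)))
      + Li2 (expR (- beta))
      - Li2 (expR (- (beta * (kl + bl)))) - Li2 (expR (- (beta * (kl + al))))
      - Li2 (expR (- (beta * (al + cl)))) - Li2 (expR (- (beta * (bl + cl)))))).
Proof.
move=> b0 k0 a0 bl0 c0 S1 kabc ck ca cb cc.
have D (u v : nat -> nat) (ul vl : R) : (fun N => (u N)%:R / N%:R) @ \oo --> ul ->
    (fun N => (v N)%:R / N%:R) @ \oo --> vl ->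
    (fun N => (u N + v N)%:R / N%:R) @ \oo --> ul + vl.
  by move=> cu cv; under eq_fun do rewrite natrD mulrDl; exact: cvgD.
have cN : (fun N => (N)%:R / N%:R) @ \oo --> (1 : R).
  apply: cvg_near_cst; near=> N; rewrite divff // pnatr_eq0 -lt0n.
  near: N; exact: nbhs_infty_gt.
pose Q := fun (m : nat -> nat) N => N%:R^-1 * ln (qpoch (qN beta N) (m N)).
have C : (fun N => ((a N)%:R / N%:R) * ((b N)%:R / N%:R) * (N%:R * ln (qN beta N))
     + (Q (fun N => k N + b N)%N N + Q (fun N => a N + c N)%N N
        + Q (fun N => k N + a N)%N N + Q (fun N => b N + c N)%N N)
     - (Q k N + Q a N + Q b N + Q c N + Q id N)) @ \oo -->
   al * bl * (- beta)
   + (beta^-1 * (Li2 (expR (- (beta * (kl + bl)))) - Li2 1)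
     + beta^-1 * (Li2 (expR (- (beta * (al + cl)))) - Li2 1)
     + beta^-1 * (Li2 (expR (- (beta * (kl + al)))) - Li2 1)
     + beta^-1 * (Li2 (expR (- (beta * (bl + cl)))) - Li2 1))
   - (beta^-1 * (Li2 (expR (- (beta * kl))) - Li2 1)
     + beta^-1 * (Li2 (expR (- (beta * al))) - Li2 1)
     + beta^-1 * (Li2 (expR (- (beta * bl))) - Li2 1)
     + beta^-1 * (Li2 (expR (- (beta * cl))) - Li2 1)
     + beta^-1 * (Li2 (expR (- (beta * 1))) - Li2 1)).
  apply: cvgB; last first.
    by repeat apply: cvgD; apply: cvg_ln_qpoch.
  apply: cvgD; last first.
    by repeat apply: cvgD; apply: cvg_ln_qpoch; rewrite ?addr_ge0 //; apply: D.
  apply: cvgM; last exact: cvg_ln_qN.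
  exact: cvgM.
rewrite mulr1 in C.
move: (Li2 1) C => z C.
have -> : forall l1 l2 l3 l4 l5 l6 l7 l8 l9 : R,
  - (beta^-1 * (beta ^+ 2 * bl * al - z + l1 + l2 + l3 + l4 + l5
      - l6 - l7 - l8 - l9)) = al * bl * (- beta)
   + (beta^-1 * (l6 - z) + beta^-1 * (l8 - z)
     + beta^-1 * (l7 - z) + beta^-1 * (l9 - z))
   - (beta^-1 * (l1 - z) + beta^-1 * (l3 - z) + beta^-1 * (l2 - z)
     + beta^-1 * (l4 - z) + beta^-1 * (l5 - z)).
  by move=> *; field; rewrite gt_eqF.
apply: cvg_trans C; apply: near_eq_cvg; near=> N.
have N0 : 0 < N%:R :> R by rewrite ltr0n; near: N; exact: nbhs_infty_gt.
have q01 : 0 < qN beta N < 1 by near: N; exact: qN_itv.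
have := hlawE (k N) (a N) (b N) (c N) q01; rewrite !kabc /Q /=.
move: (qN beta N) q01 => q q01; set h := hlaw _ _ _ _ _ => E.
have q0 : 0 < q by case/andP: q01.
have P m : 0 < qpoch q m by exact: qpoch_gt0.
have h0 : 0 < h.
  have : 0 < q ^+ (a N * b N) * (qpoch q (k N + b N) * qpoch q (a N + c N) *
       qpoch q (k N + a N) * qpoch q (b N + c N)).
    by rewrite !mulr_gt0 ?exprn_gt0.
  by rewrite -E pmulr_lgt0 // !mulr_gt0.
have := congr1 (@ln R) E.
rewrite !(lnM, lnXn) ?posrE ?mulr_gt0 ?exprn_gt0 // => {}E.
rewrite -(addrK (ln (qpoch q (k N)) + ln (qpoch q (a N)) + ln (qpoch q (b N)) +
      ln (qpoch q (c N)) + ln (qpoch q N)) (ln h)) E -[ln q *+ _]mulr_natr natrM.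
by field; rewrite gt_eqF.
Unshelve. all: by end_near. Qed.

Lemma cvg_drift (R : realType) (beta : R) (k a b c : nat -> nat)
    (kl al bl cl : R) : 0 < beta ->
  (fun N => (k N)%:R / N%:R) @ \oo --> kl ->
  (fun N => (a N)%:R / N%:R) @ \oo --> al ->
  (fun N => (b N)%:R / N%:R) @ \oo --> bl ->
  (fun N => (c N)%:R / N%:R) @ \oo --> cl ->
  (fun N => drift (qN beta N) (k N) (a N) (b N) (c N)) @ \oo -->
  expR (- (beta * al)) * expR (- (beta * bl)) *
    ((1 - expR (- (beta * kl))) * (1 - expR (- (beta * cl))))
  - (1 - expR (- (beta * al))) * (1 - expR (- (beta * bl))).
Proof.
move=> b0 ck ca cb cc; have P := fun m l => @cvg_qN_expr R beta l m b0.
have O (m : nat -> nat) (l : R) : (fun N => (m N)%:R / N%:R) @ \oo --> l ->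
    (fun N => 1 - qN beta N ^+ m N) @ \oo --> 1 - expR (- (beta * l)).
  by move=> ml; apply: cvgB; [exact: cvg_cst|exact: P].
under eq_fun do rewrite /drift exprD.
apply: cvgB; last by apply: cvgM; exact: O.
apply: cvgM; last by apply: cvgM; exact: O.
by apply: cvgM; exact: P.
Qed.

(** The limiting mode $h_\beta(x, y)$, in exponential form *)
Lemma expR_h_limit (R : realType) (beta x y : R) : 0 < beta ->
  0 < x < 1 -> 0 < y < 1 ->
  (1 - expR (- beta)) * expR (- (beta * h_limit beta x y)) =
  expR (- (beta * x)) + expR (- (beta * y))
    - expR (- (beta * x)) * expR (- (beta * y)) - expR (- beta).
Proof.
move=> b0 /andP[x0 x1] /andP[y0 y1].
have A1 : expR (- (beta * x)) < 1 by rewrite expR_lt1 oppr_lt0 mulr_gt0.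
have C1 : expR (- beta) < 1 by rewrite expR_lt1 oppr_lt0.
have AC : expR (- beta) < expR (- (beta * x)).
  by rewrite ltr_expR ltrN2 gtr_pMr.
have B0 := expR_gt0 (- (beta * y)).
rewrite /h_limit mulrA divff ?gt_eqF // mul1r [beta * (x + y)]mulrDr.
rewrite [- (beta * x + _)]opprD expRD opprB expRB !lnK ?posrE ?subr_gt0 //.
  2: by nra.
by field; rewrite subr_eq0 gt_eqF.
Qed.

Lemma h_limit_itv (R : realType) (beta x y : R) : 0 < beta ->
  0 < x < 1 -> 0 < y < 1 ->
  Num.max (x + y - 1) 0 < h_limit beta x y < Num.min x y.
Proof.
move=> b0 x01 y01; have := expR_h_limit b0 x01 y01.
move: x01 y01 => /andP[x0 x1] /andP[y0 y1].
have A1 : expR (- (beta * x)) < 1 by rewrite expR_lt1 oppr_lt0 mulr_gt0.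
have B1 : expR (- (beta * y)) < 1 by rewrite expR_lt1 oppr_lt0 mulr_gt0.
have C1 : expR (- beta) < 1 by rewrite expR_lt1 oppr_lt0.
have AC : expR (- beta) < expR (- (beta * x)).
  by rewrite ltr_expR ltrN2 gtr_pMr.
have BC : expR (- beta) < expR (- (beta * y)).
  by rewrite ltr_expR ltrN2 gtr_pMr.
have C0 := expR_gt0 (- beta).
have M u v : (u < v) = (expR (- (beta * v)) < expR (- (beta * u))).
  by rewrite ltr_expR ltrN2 ltr_pM2l.
rewrite gt_max lt_min (M (x + y - 1)) (M 0) (M _ x) (M _ y) mulr0 oppr0 expR0.
have -> : - (beta * (x + y - 1)) = - (beta * x) + - (beta * y) - - beta by ring.
rewrite expRB expRD; move: (expR (- (beta * h_limit beta x y))) => u.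
move: (expR (- (beta * x))) (expR (- (beta * y))) (expR (- beta)) A1 B1 C1 AC BC C0.
move=> A B C A1 B1 C1 AC BC C0 E.
have C1' : 0 < 1 - C by rewrite subr_gt0.
have P1 : 0 < (A - C) * (B - C) by rewrite mulr_gt0 ?subr_gt0.
have P2 : 0 < (1 - A) * (1 - B) by rewrite mulr_gt0 ?subr_gt0.
have P3 : 0 < (1 - A) * (B - C) by rewrite mulr_gt0 ?subr_gt0.
have P4 : 0 < (1 - B) * (A - C) by rewrite mulr_gt0 ?subr_gt0.
rewrite ltr_pdivlMr // -!andbA; apply/and4P; split;
  rewrite -(ltr_pM2l C1') ?(mulrA _ u C) E; lra.
Qed.

Lemma cvg_ln_succ (R : realType) :
  (fun N : nat => N%:R^-1 * ln (N.+1%:R : R)) @ \oo --> (0 : R).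
Proof.
apply/cvgrPdist_le => e e0; near=> N.
have N0 : 0 < N%:R :> R by rewrite ltr0n; near: N; exact: nbhs_infty_gt.
rewrite sub0r normrN ger0_norm; last first.
  by rewrite mulr_ge0 ?invr_ge0 ?ln_ge0 // ?ler1n // ltW.
rewrite mulrC ler_pdivrMr //.
rewrite -[leRHS]expRK ler_ln ?posrE ?expR_gt0 ?ltr0n //.
have eN : 0 <= e * N%:R by rewrite mulr_ge0 ?ltW.
apply: le_trans (expR_ge1Dxn 1 eN).
have H : 2 <= N%:R * e ^+ 2.
  by rewrite -ler_pdivrMr ?exprn_gt0 //; near: N; exact: nbhs_infty_ger.
rewrite -natr1 addrC lerD2l (_ : (2`! = 2)%N) // ler_pdivlMr //.
have -> : (e * N%:R) ^+ 2 = N%:R * e ^+ 2 * N%:R by ring.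
by rewrite mulrC ler_pM2r.
Unshelve. all: by end_near. Qed.

Lemma truncn_quadrants (R : realType) (x y delta : R) (N : nat) :
  0 < x < 1 -> 0 < y < 1 -> Num.max (x + y - 1) 0 <= delta <= Num.min x y ->
  let k := Num.truncn (delta * N%:R) in
  let L := Num.truncn (x * N%:R) in
  let K := Num.truncn (y * N%:R) in
  [/\ (k <= L)%N, (k <= K)%N, (L <= N)%N, (K <= N)%N & (L + K <= N + k)%N].
Proof.
move=> /andP[x0 x1] /andP[y0 y1]; rewrite ge_max le_min.
move=> /andP[/andP[d1 d0] /andP[dx dy]] k L K.
have N0 : 0 <= N%:R :> R by [].
have M (s t : R) : s <= t -> (Num.truncn (s * N%:R) <= Num.truncn (t * N%:R))%N.
  by move=> st; apply: le_truncn; rewrite ler_wpM2r.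
have E : Num.truncn (1 * N%:R : R) = N by rewrite mul1r natrK.
split; [exact: M|exact: M| | |].
- by rewrite -[leqRHS]E M // ltW.
- by rewrite -[leqRHS]E M // ltW.
have /andP[L1 _] := truncn_itv (mulr_ge0 (ltW x0) N0).
have /andP[K1 _] := truncn_itv (mulr_ge0 (ltW y0) N0).
have /andP[_ k1] := truncn_itv (mulr_ge0 d0 N0).
rewrite -/L -/K -/k in L1 K1 k1.
rewrite -ltnS -[(N + k).+1]addnS -(ltr_nat R) !natrD.
apply: (@le_lt_trans _ _ ((x + y) * N%:R)).
  by rewrite mulrDl lerD.
apply: (@le_lt_trans _ _ (N%:R + delta * N%:R)); last by rewrite ltrD2l.
have -> : N%:R + delta * N%:R = (1 + delta) * N%:R by ring.
by rewrite ler_wpM2r //; lra.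
Qed.

(** * Large deviations of the height *)

(** The numbers of points of the permutation in the four quadrants, when the
    height is $\lfloor \delta N \rfloor$, and their limiting proportions *)
Lemma quadrant_proportions (R : realType) (x y delta : R) :
  0 < x < 1 -> 0 < y < 1 -> Num.max (x + y - 1) 0 <= delta <= Num.min x y ->
  let k := fun N : nat => Num.truncn (delta * N%:R) in
  exists a b c : nat -> nat,
    [/\ forall N, (k N + b N)%N = Num.truncn (x * N%:R),
        forall N, (k N + a N)%N = Num.truncn (y * N%:R),
        forall N, (k N + a N + b N + c N)%N = N
      & [/\ (fun N => (k N)%:R / N%:R) @ \oo --> delta,
            (fun N => (a N)%:R / N%:R) @ \oo --> y - delta,
            (fun N => (b N)%:R / N%:R) @ \oo --> x - delta
          & (fun N => (c N)%:R / N%:R) @ \oo --> 1 - x - y + delta]].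
Proof.
move=> x01 y01 d k.
pose L := fun N : nat => Num.truncn (x * N%:R).
pose K := fun N : nat => Num.truncn (y * N%:R).
have := d; rewrite ge_max le_min => /andP[/andP[_ d0] _].
have /andP[x0 _] := x01; have /andP[y0 _] := y01.
have T N : [/\ (k N <= L N)%N, (k N <= K N)%N, (L N <= N)%N, (K N <= N)%N
    & (L N + K N <= N + k N)%N] by exact: truncn_quadrants.
have ck : (fun N => (k N)%:R / N%:R) @ \oo --> delta by exact: cvg_truncn.
have cL : (fun N => (L N)%:R / N%:R) @ \oo --> x by exact/cvg_truncn/ltW.
have cK : (fun N => (K N)%:R / N%:R) @ \oo --> y by exact/cvg_truncn/ltW.
have EL N : Num.truncn (x * N%:R) = L N by [].
have EK N : Num.truncn (y * N%:R) = K N by [].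
clearbody k L K.
have cN : (fun N => (N)%:R / N%:R) @ \oo --> (1 : R).
  apply: cvg_near_cst; near=> N; rewrite divff // pnatr_eq0 -lt0n.
  near: N; exact: nbhs_infty_gt.
exists (fun N => K N - k N)%N, (fun N => L N - k N)%N,
  (fun N => N + k N - (L N + K N))%N.
split => [N|N|N|]; rewrite ?EL ?EK; try by have [] := T N; lia.
split => //.
- rewrite (_ : (fun N => _) = fun N => (K N)%:R / N%:R - (k N)%:R / N%:R).
    exact: cvgB.
  by apply/funext => N; have [_ h _ _ _] := T N; rewrite natrB // mulrBl.
- rewrite (_ : (fun N => _) = fun N => (L N)%:R / N%:R - (k N)%:R / N%:R).
    exact: cvgB.
  by apply/funext => N; have [h _ _ _ _] := T N; rewrite natrB // mulrBl.
- rewrite (_ : (fun N => _) = fun N => (N%:R / N%:R + (k N)%:R / N%:R)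
      - ((L N)%:R / N%:R + (K N)%:R / N%:R)).
    rewrite (_ : 1 - x - y + delta = 1 + delta - (x + y)); last by ring.
    by apply: cvgB; apply: cvgD.
  apply/funext => N; have [_ _ _ _ h] := T N.
  by rewrite natrB // mulrBl !natrD !mulrDl.
Unshelve. all: by end_near. Qed.

(** If $\lfloor \delta N \rfloor$ is eventually the most likely height in an
    event, then the event has the same exponential rate as this single value. *)
Lemma cvg_ln_height_event (R : realType) (beta x y delta : R)
    (A : nat -> pred nat) : 0 < beta -> 0 < x < 1 -> 0 < y < 1 ->
  Num.max (x + y - 1) 0 <= delta <= Num.min x y ->
  let k := fun N : nat => Num.truncn (delta * N%:R) in
  let L := fun N : nat => Num.truncn (x * N%:R) in
  let K := fun N : nat => Num.truncn (y * N%:R) in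
  (forall N, A N (k N)) ->
  (\forall N \near \oo, forall j, A N j ->
    hlaw (qN beta N) N (L N) (K N) j <= hlaw (qN beta N) N (L N) (K N) (k N)) ->
  (fun N : nat => N%:R^-1 *
     ln (mallows (qN beta N) [set w : 'S_N | A N (height w (L N) (K N))]%SET))
    @ \oo --> - a_rate beta x y delta.
Proof.
move=> b0 x01 y01 d k L K Ak HA.
have [a [b [c [kb ka kabc [ck ca cb cc]]]]] := quadrant_proportions x01 y01 d.
have := d; rewrite ge_max le_min => /andP[/andP[d1 d0] /andP[dx dy]].
rewrite -/k in kb ka kabc ck.
have C : (fun N => N%:R^-1 * ln (hlaw (qN beta N) N (L N) (K N) (k N))) @ \oo
    --> - a_rate beta x y delta.
  have := @cvg_ln_hlaw R beta k a b c delta (y - delta) (x - delta)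
    (1 - x - y + delta) b0 d0.
  rewrite (_ : (fun N => _ * ln _) =
    (fun N => N%:R^-1 * ln (hlaw (qN beta N) N (L N) (K N) (k N)))); last first.
    by apply/funext => N; rewrite kb ka.
  rewrite Li2_1 /a_rate.
  have -> : delta + (x - delta) = x by ring.
  have -> : delta + (y - delta) = y by ring.
  have -> : y - delta + (1 - x - y + delta) = 1 - x by ring.
  have -> : x - delta + (1 - x - y + delta) = 1 - y by ring.
  move=> H; apply: H => //; lra.
apply: (@squeeze_cvgr _ _ _ _
   (fun N => N%:R^-1 * ln (hlaw (qN beta N) N (L N) (K N) (k N)))
   (fun N => N%:R^-1 * ln N.+1%:R
      + N%:R^-1 * ln (hlaw (qN beta N) N (L N) (K N) (k N)))); last 2 first.
- exact: C.
- by rewrite -[X in _ --> X]add0r; apply: cvgD => //; exact: cvg_ln_succ.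
near=> N.
have q01 : 0 < qN beta N < 1 by near: N; exact: qN_itv.
have H : forall j, A N j ->
    hlaw (qN beta N) N (L N) (K N) j <= hlaw (qN beta N) N (L N) (K N) (k N).
  by near: N.
have [kL _ LN KN _] := truncn_quadrants N x01 y01 d.
have /andP[B1 B2] := mallows_height_bounds q01 LN (leq_trans kL LN) (Ak N) H.
have h0 : 0 < hlaw (qN beta N) N (L N) (K N) (k N).
  have := hlawE (k N) (a N) (b N) (c N) q01; rewrite kabc kb ka => E.
  have /andP[q0 _] := q01.
  have Q0 : 0 < qpoch (qN beta N) (k N) * qpoch (qN beta N) (a N)
    * qpoch (qN beta N) (b N) * qpoch (qN beta N) (c N) * qpoch (qN beta N) N.
    by rewrite !mulr_gt0 ?qpoch_gt0.
  by rewrite -(pmulr_lgt0 _ Q0) E !mulr_gt0 ?exprn_gt0 ?qpoch_gt0.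
have N1 : 0 <= (N%:R : R)^-1 by rewrite invr_ge0.
have m0 := lt_le_trans h0 B1.
rewrite -mulrDr -lnM ?posrE ?ltr0n //.
by apply/andP; split; apply: ler_wpM2l => //; rewrite ler_ln ?posrE ?mulr_gt0.
Unshelve. all: by end_near. Qed.

(** The limiting drift at height $\delta N$ has the sign of
    $\delta - h_\beta(x, y)$. *)
Lemma drift_limitE (R : realType) (beta x y delta : R) : 0 < beta ->
  0 < x < 1 -> 0 < y < 1 ->
  expR (- (beta * (y - delta))) * expR (- (beta * (x - delta))) *
    ((1 - expR (- (beta * delta))) * (1 - expR (- (beta * (1 - x - y + delta)))))
  - (1 - expR (- (beta * (y - delta)))) * (1 - expR (- (beta * (x - delta)))) =
  (1 - expR (- beta)) / expR (- (beta * delta)) *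
    (expR (- (beta * h_limit beta x y)) - expR (- (beta * delta))).
Proof.
move=> b0 x01 y01.
have -> : forall a b c : R, a / b * (c - b) = (a * c - a * b) / b.
  by move=> *; ring.
rewrite (expR_h_limit b0 x01 y01).
have E t : - (beta * (t - delta)) = - (beta * t) - - (beta * delta) by ring.
rewrite !E (_ : - (beta * (1 - x - y + delta)) = - beta + - (beta * delta)
  - (- (beta * x) + - (beta * y))); last by ring.
move: (- (beta * x)) (- (beta * y)) (- (beta * delta)) (- beta) => a b u c.
rewrite !expRB !expRD.
have A0 := expR_gt0 a; have B0 := expR_gt0 b; have U0 := expR_gt0 u.
move: (expR a) (expR b) (expR u) (expR c) A0 B0 U0 => A B U C A0 B0 U0.
by field; rewrite !gt_eqF.
Qed.

Theorem theorem4p4 (R : realType) (beta : R) (hbeta : 0 < beta) (x y : R)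
    (hx : 0 < x < 1) (hy : 0 < y < 1) :
  (forall delta : R, h_limit beta x y < delta <= Num.min x y ->
    (fun N : nat => N%:R^-1 *
       ln (mallows (1 - beta / N%:R)
             [set w : 'S_N | (Num.truncn (delta * N%:R) <=
                height w (Num.truncn (x * N%:R)) (Num.truncn (y * N%:R)))%N]%SET))
      @ \oo --> - a_rate beta x y delta)
  /\
  (forall delta : R, Num.max (x + y - 1) 0 <= delta < h_limit beta x y ->
    (fun N : nat => N%:R^-1 *
       ln (mallows (1 - beta / N%:R)
             [set w : 'S_N | (height w (Num.truncn (x * N%:R)) (Num.truncn (y * N%:R))
                <= Num.truncn (delta * N%:R))%N]%SET))
      @ \oo --> - a_rate beta x y delta).
Proof.
have /andP[h1 h2] := h_limit_itv hbeta hx hy.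
have C0 delta : 0 < (1 - expR (- beta)) / expR (- (beta * delta)) :> R.
  by rewrite divr_gt0 ?expR_gt0 // subr_gt0 expR_lt1 oppr_lt0.
split => delta /andP[d1 d2].
- have d : Num.max (x + y - 1) 0 <= delta <= Num.min x y.
    by rewrite d2 andbT ltW // (lt_trans h1).
  apply: (cvg_ln_height_event
    (A := fun N j => (Num.truncn (delta * N%:R) <= j)%N) hbeta hx hy d) => //.
  have /= [a [b [c [kb ka kabc [ck ca cb cc]]]]] := quadrant_proportions hx hy d.
  have /cvgr_gt D := cvg_drift hbeta ck ca cb cc.
  have {}D := D 0; rewrite drift_limitE // in D.
  have {}D := D ltac:(by rewrite pmulr_rgt0 // subr_gt0 ltr_expR ltrN2 ltr_pM2l).
  near=> N => j kj.
  have q01 : 0 < qN beta N < 1 by near: N; exact: qN_itv.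
  have DN : 0 <= drift (qN beta N) (Num.truncn (delta * N%:R)) (a N) (b N) (c N).
    by apply: ltW; near: N.
  by have := hlaw_le_mode q01 DN kj; rewrite kabc kb ka.
- have d : Num.max (x + y - 1) 0 <= delta <= Num.min x y.
    by rewrite d1 /= ltW // (lt_trans d2).
  apply: (cvg_ln_height_event
    (A := fun N j => (j <= Num.truncn (delta * N%:R))%N) hbeta hx hy d) => //.
  have /= [a [b [c [kb ka kabc [ck ca cb cc]]]]] := quadrant_proportions hx hy d.
  have /cvgr_lt D := cvg_drift hbeta ck ca cb cc.
  have {}D := D 0; rewrite drift_limitE // in D.
  have {}D := D ltac:(by rewrite pmulr_rlt0 // subr_lt0 ltr_expR ltrN2 ltr_pM2l).
  near=> N => j kj.
  have q01 : 0 < qN beta N < 1 by near: N; exact: qN_itv.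
  have DN : drift (qN beta N) (Num.truncn (delta * N%:R)) (a N) (b N) (c N) <= 0.
    by apply: ltW; near: N.
  by have := hlaw_ge_mode q01 DN kj; rewrite kabc kb ka.
Unshelve. all: by end_near. Qed.
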